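(* The set of all complex structures on $\mathfrak{su}(2)\oplus\mathfrak{su}(2)$, viewed as a subset of $\mathbb{R}^{36}$ (real $6\times6$ matrices), is a closed 6-dimensional smooth submanifold of $\mathbb{R}^{36}$ diffeomorphic to $\mathbb{R}\times\mathbb{R}^*\times(\mathbb{S}^2)^2$.
   Context: $\mathfrak{su}(2)\oplus\mathfrak{su}(2)$ has basis $(J^{(1)}_1,J^{(1)}_2,J^{(1)}_3,J^{(2)}_1,J^{(2)}_2,J^{(2)}_3)$, where for each $k=1,2$: $[J^{(k)}_1,J^{(k)}_2]=J^{(k)}_3$, $[J^{(k)}_2,J^{(k)}_3]=J^{(k)}_1$, $[J^{(k)}_3,J^{(k)}_1]=J^{(k)}_2$, and brackets between different factors vanish. Linear maps are identified with their $6\times6$ matrices in this basis. A complex structure on a real Lie algebra $\mathfrak{g}$ is a linear map $J:\mathfrak{g}\to\mathfrak{g}$ with $J^2=-1$ and $[JX,JY]-[X,Y]-J[JX,Y]-J[X,JY]=0$ for all $X,Y\in\mathfrak{g}$. $\mathbb{R}^*=\mathbb{R}\setminus\{0\}$ and $\mathbb{S}^2$ is the unit sphere in $\mathbb{R}^3$. *)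

(* Defs.v *)
From HB Require Import structures.
From mathcomp Require Import all_boot all_order all_algebra.
From mathcomp Require Import mathcomp_extra boolp classical_sets functions reals.
From mathcomp Require Import topology normedtype derive.
From mathcomp Require Import ring.

Set Implicit Arguments.
Unset Strict Implicit.
Unset Printing Implicit Defensive.

Import Order.TTheory GRing.Theory Num.Theory.
Import numFieldNormedType.Exports.

Local Open Scope classical_set_scope.
Local Open Scope ring_scope.

Section Smooth.
Context {R : realType}.

(* f is of class C^k on the open set U.  Intended for finite-dimensional V and W,
   where f is C^(k+1) iff it is differentiable and every directional derivative
   x |-> 'D_v f x is C^k (take v in a basis). *)
Fixpoint C_on {V W : normedModType R} (k : nat) (U : set V) (f : V -> W) : Prop :=
  match k with
  | 0 => forall x, U x -> {for x, continuous f}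
  | k'.+1 => (forall x, U x -> differentiable f x) /\
             (forall v : V, C_on k' U (fun x => 'D_v f x))
  end.

(* Smoothness on an arbitrary subset A: local extendability to a C^infinity map
   on an open neighbourhood.  Values of f outside A are irrelevant.  For open A
   this is C^infinity on A; for an embedded submanifold it is smoothness for the
   manifold structure. *)
Definition smooth_on {V W : normedModType R} (A : set V) (f : V -> W) : Prop :=
  forall p, A p -> exists U : set V, exists g : V -> W,
    [/\ open U, U p, (forall k, C_on k U g) & (forall x, A x -> U x -> f x = g x)].

Definition diffeo_between {V W : normedModType R}
    (A : set V) (B : set W) (f : V -> W) (g : W -> V) : Prop :=
  [/\ smooth_on A f, smooth_on B g,
      (forall x, A x -> B (f x) /\ g (f x) = x) &
      (forall y, B y -> A (g y) /\ f (g y) = y)].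

Definition diffeomorphic {V W : normedModType R} (A : set V) (B : set W) : Prop :=
  exists (f : V -> W) (g : W -> V), diffeo_between A B f g.

(* R^d x {0} inside R^n *)
Definition slice (n d : nat) : set 'rV[R]_n :=
  [set y | forall i : 'I_n, (d <= i)%N -> y 0 i = 0].
Arguments slice n d _ : clear implicits.

(* Embedded d-dimensional submanifold of an n-dimensional space V, by slice
   charts (the existence of a chart forces dim V = n). *)
Definition smooth_submanifold {V : normedModType R} (n d : nat) (M : set V) : Prop :=
  (d <= n)%N /\
  forall p, M p -> exists (U : set V) (O : set 'rV[R]_n)
                          (f : V -> 'rV[R]_n) (g : 'rV[R]_n -> V),
    [/\ open U, U p, open O, diffeo_between U O f g &
        f @` (M `&` U) = O `&` slice n d].

End Smooth.

Section Lie.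
Context {R : realType}.

(* Linear endomorphisms are matrices acting on column vectors, so column j of J
   holds the coordinates of the image of the j-th basis vector. *)
Definition complex_structure (n : nat) (br : 'cV[R]_n -> 'cV[R]_n -> 'cV[R]_n)
    (J : 'M[R]_n) : Prop :=
  J *m J = - 1%:M /\
  forall X Y : 'cV[R]_n,
    br (J *m X) (J *m Y) - br X Y - J *m br (J *m X) Y - J *m br X (J *m Y) = 0.

(* Indices in 'I_3 are added modulo 3: [e_i, e_(i+1)] = e_(i+2). *)
Definition su2_bracket (u v : 'cV[R]_3) : 'cV[R]_3 :=
  \col_(i < 3) (u (i + 1) 0 * v (i + 2%:R) 0 - u (i + 2%:R) 0 * v (i + 1) 0).

(* Coordinates 0,1,2 are the first factor and 3,4,5 the second one. *)
Definition su2su2_bracket (X Y : 'cV[R]_6) : 'cV[R]_6 :=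
  let X' : 'cV[R]_(3 + 3) := X in
  let Y' : 'cV[R]_(3 + 3) := Y in
  col_mx (su2_bracket (usubmx X') (usubmx Y'))
         (su2_bracket (dsubmx X') (dsubmx Y')).

Definition unit_sphere (n : nat) : set 'rV[R]_n.+1 :=
  [set x | \sum_(i < n.+1) x 0 i ^+ 2 = 1].

(* R x R^* x (S^2)^2 *)
Definition model_space : set ((R * R) * ('rV[R]_3 * 'rV[R]_3))%type :=
  [set q | [/\ q.1.2 != 0, unit_sphere q.2.1 & unit_sphere q.2.2]].

Definition su2su2_basis (k : 'I_2) (i : 'I_3) : 'cV[R]_6 :=
  delta_mx (inord (3 * k + i)) 0.

Let coordE (X : 'cV[R]_6) (i j : 'I_6) : i = j :> nat -> X i 0 = X j 0.
Proof. by move=> /val_inj ->. Qed.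

Let idx_lt (k : 'I_2) (i : 'I_3) : (3 * k + i < 6)%N.
Proof. by case: k => -[|[|//]] ?; case: i => -[|[|[|//]]]. Qed.

Lemma su2su2_bracket_entry (X Y : 'cV[R]_6) (k : 'I_2) (i : 'I_3) :
  su2su2_bracket X Y (inord (3 * k + i)) 0 =
  X (inord (3 * k + (i + 1)%R)) 0 * Y (inord (3 * k + (i + 2%:R)%R)) 0
  - X (inord (3 * k + (i + 2%:R)%R)) 0 * Y (inord (3 * k + (i + 1)%R)) 0.
Proof.
case: (eqVneq (k : nat) 0%N) => [k0|k1].
  rewrite [inord (3 * k + i)](_ : _ = lshift 3 i :> 'I_(3 + 3)); last first.
    by apply: val_inj; rewrite /= inordK ?idx_lt // k0.
  apply: etrans (col_mxEu _ _ i 0) _; rewrite !mxE.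
  by congr (_ * _ - _ * _); apply: coordE; rewrite inordK ?idx_lt // k0.
have {}k1 : (k : nat) = 1%N by case: k k1 => -[|[|//]].
rewrite [inord (3 * k + i)](_ : _ = rshift 3 i :> 'I_(3 + 3)); last first.
  by apply: val_inj; rewrite /= inordK ?idx_lt // k1.
apply: etrans (col_mxEd _ _ i 0) _; rewrite !mxE.
by congr (_ * _ - _ * _); apply: coordE; rewrite inordK ?idx_lt // k1.
Qed.

Let basisE (k l : 'I_2) (i j : 'I_3) :
  su2su2_basis k i (inord (3 * l + j)) 0 = ((k == l) && (i == j))%:R.
Proof.
rewrite mxE eqxx andbT; congr (_%:R); congr nat_of_bool.
rewrite -val_eqE /=.
by case: k => -[|[|//]] ?; case: l => -[|[|//]] ?;
   case: i => -[|[|[|//]]] ?; case: j => -[|[|[|//]]] ? /=; rewrite !inordK.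
Qed.

Let vecP (X Y : 'cV[R]_6) :
  (forall (k : 'I_2) (i : 'I_3), X (inord (3 * k + i)) 0 = Y (inord (3 * k + i)) 0) ->
  X = Y.
Proof.
move=> H; apply/colP => m.
have hk : (m %/ 3 < 2)%N by rewrite ltn_divLR.
have hi : (m %% 3 < 3)%N by rewrite ltn_pmod.
have := H (Ordinal hk) (Ordinal hi).
by rewrite /= mulnC -divn_eq inord_val.
Qed.

Lemma su2su2_bracket_same (k : 'I_2) (i : 'I_3) :
  su2su2_bracket (su2su2_basis k i) (su2su2_basis k (i + 1)) =
  su2su2_basis k (i + 2%:R).
Proof.
apply: vecP => l j; rewrite su2su2_bracket_entry !basisE.
by case: eqP => [_|] /=; last (by rewrite !mul0r subrr);
   case: i => -[|[|[|//]]] ?; case: j => -[|[|[|//]]] ?;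
   rewrite -!val_eqE /= ?(mul0r, mulr0, mul1r, subr0, subrr).
Qed.

Lemma su2su2_bracket_diff (k l : 'I_2) (i j : 'I_3) : k != l ->
  su2su2_bracket (su2su2_basis k i) (su2su2_basis l j) = 0.
Proof.
move=> kl; apply: vecP => m h; rewrite su2su2_bracket_entry !basisE mxE.
case: (eqVneq k m) => [<-|_] /=; last by rewrite !mul0r subrr.
by rewrite (eq_sym l k) (negPf kl) /= !mulr0 subrr.
Qed.

Lemma su2su2_bracket_linear (a : R) (X Y Z : 'cV[R]_6) :
  su2su2_bracket (a *: X + Y) Z = a *: su2su2_bracket X Z + su2su2_bracket Y Z.
Proof.
by apply: vecP => k i; rewrite [RHS]mxE [X in _ = X + _]mxE
  !su2su2_bracket_entry !mxE; ring.
Qed.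

Lemma su2su2_bracketC (X Y : 'cV[R]_6) : su2su2_bracket X Y = - su2su2_bracket Y X.
Proof.
by apply: vecP => k i; rewrite [RHS]mxE !su2su2_bracket_entry; ring.
Qed.

End Lie.

(* Main.v *)
Require Import Defs.
From HB Require Import structures.
From mathcomp Require Import all_boot all_order all_algebra.
From mathcomp Require Import mathcomp_extra boolp classical_sets functions reals.
From mathcomp Require Import topology normedtype derive realfun landau.
From mathcomp Require Import ring lra.

(** Write a complex structure as J = [[A, B], [C, D]] in 3x3 blocks. The torsion condition on pairs
   from the same factor says cof A = 1 + tr(A) A - A A^T and cof C = C (tr(A) - A^T), and likewise
   for D and B. These equations exclude det C <> 0 (A would be symmetric and then, by
   Cayley-Hamilton, a scalar matrix, against the trace of the first equation), and det C = 0 forces cof C = 0.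
   Hence B and C have rank one; with J^2 = -1 and the trace of the first equation this leaves only
   A = xi u u^T + [u]x, D = -xi v v^T + [v]x, C = eta v u^T, B = -(xi^2 + 1)/eta u v^T
   with u and v unit vectors and eta <> 0. The parameters are polynomial functions of J
   (xi = tr A, u and v are the axial vectors of A and D, eta = v^T C u), which gives the
   diffeomorphism. Near a point with u_a <> 0 and v_b <> 0 the set is the graph of a smooth function
   of the six linear coordinates tr A, C_ba, u_(a+1), u_(a+2), v_(b+1), v_(b+2), and a graph is
   flattened by a shear. *)

Set Implicit Arguments.
Unset Strict Implicit.
Unset Printing Implicit Defensive.

Import Order.TTheory GRing.Theory Num.Theory.
Import numFieldNormedType.Exports.
Local Open Scope classical_set_scope.
Local Open Scope ring_scope.

(** * Smooth functions *)

Section SmoothFunctions.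
Context {R : realType}.
Implicit Types V W : normedModType R.

(** The first-order expansion of [f] at [x] is also one of [g], because the two error terms coincide
    near 0. Smoothness of functions known only on an open set rests on this. *)
Lemma near_eq_differentiable V W (f g : V -> W) (x : V) :
  (\near x, f x = g x) -> differentiable f x -> differentiable g x.
Proof.
move=> fg df.
have [dc dE] : continuous ('d f x) /\
    g \o shift x = cst (g x) + 'd f x +o_ 0 id.
  split; first exact: diff_continuous.
  have /eqaddoP fE : f \o shift x = cst (f x) + 'd f x +o_ 0 id by apply: diff_locally.
  apply/eqaddoP => e e0; have := fE e e0.
  have fgx : f x = g x by exact: (nbhs_singleton fg).
  move: fg; rewrite (near_shift 0 x) => fg.
  apply: filter_app; near=> h.
  have -> : (f \o shift x - (cst (f x) + 'd f x)) h = (g \o shift x - (cst (g x) + 'd f x)) h;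
    last by [].
  rewrite !fctE fgx; congr (_ - _) => /=.
  have : (f \o shift (x - 0)) h = (g \o shift (x - 0)) h by near: h.
  by rewrite /= subr0.
by apply/diff_locallyP; rewrite (diff_unique dc dE).
Unshelve. all: by end_near. Qed.

(* Stable under directional derivatives, hence contained in C_on k for every k: closure under
   products needs no Leibniz formula for higher derivatives. *)
Inductive smooth_fun {V} (U : set V) : (V -> R) -> Prop :=
| smooth_fun_eq f g of (forall x, U x -> f x = g x) & smooth_fun U f : smooth_fun U g
| smooth_fun_cst c : smooth_fun U (fun=> c)
| smooth_fun_lin (f : {linear V -> R^o}) of continuous f : smooth_fun U f
| smooth_funD f g of smooth_fun U f & smooth_fun U g : smooth_fun U (fun x => f x + g x)
| smooth_funM f g of smooth_fun U f & smooth_fun U g : smooth_fun U (fun x => f x * g x)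
| smooth_funV f of (forall x, U x -> f x != 0) & smooth_fun U f :
    smooth_fun U (fun x => (f x)^-1)
| smooth_fun_sqrt f of (forall x, U x -> 0 < f x) & smooth_fun U f :
    smooth_fun U (fun x => Num.sqrt (f x)).

(** Finite sums of scalar functions times fixed vectors suffice for the finite-dimensional targets
    met below, and they reduce derivatives to the scalar case. *)
Inductive smooth_map {V W} (U : set V) : (V -> W) -> Prop :=
| smooth_map_eq f g of (forall x, U x -> f x = g x) & smooth_map U f : smooth_map U g
| smooth_mapZ (a : V -> R) w of smooth_fun U a : smooth_map U (fun x => a x *: w)
| smooth_mapD f g of smooth_map U f & smooth_map U g : smooth_map U (fun x => f x + g x).

Lemma smooth_fun_differentiable V (U : set V) (f : V -> R) : open U ->
  smooth_fun U f -> forall x, U x -> differentiable f x.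
Proof.
move=> oU; elim => {f} [f g fg _ IH|c|f cf|f g _ IHf _ IHg|f g _ IHf _ IHg|f f0 _ IH|f f0 _ IH] x
  Ux.
- apply: near_eq_differentiable (IH _ Ux).
  by near=> y; apply: fg; near: y; exact: open_nbhs_nbhs.
- exact: differentiable_cst.
- exact: linear_differentiable.
- by apply: differentiableD; [exact: IHf|exact: IHg].
- by apply: differentiableM; [exact: IHf|exact: IHg].
- by apply: differentiableV; [exact: IH|exact: f0].
- apply: (@differentiable_comp _ _ _ _ f Num.sqrt); first exact: IH.
  by apply/derivable1_diffP; have [] := is_derive1_sqrt (f0 x Ux).
Unshelve. all: by end_near. Qed.

Lemma derive_sqrt_comp V (f : V -> R) x v : 0 < f x -> differentiable f x ->
  'D_v (fun x => Num.sqrt (f x)) x = (2 * Num.sqrt (f x))^-1 * 'D_v f x.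
Proof.
move=> f0 df; have [ds dsE] := is_derive1_sqrt f0.
have /derivable1_diffP dsq := ds.
rewrite [LHS]deriveE; last exact: (@differentiable_comp _ _ _ _ f Num.sqrt).
rewrite [X in X v = _](@diff_comp _ _ _ _ f Num.sqrt) //=.
(* A linear map on the line is multiplication by its value at 1, here the derivative of the square
   root. *)
rewrite -[X in 'd Num.sqrt _ X]mulr1 [LHS]linearZ -(deriveE _ dsq) dsE.
by rewrite deriveE // [LHS]mulrC.
Qed.

(** Induction on the construction: the rules for sums, products, inverses and square roots express
    each derivative by the same constructors applied to the pieces and their derivatives. *)
Lemma smooth_fun_derive V (U : set V) (f : V -> R) v : open U ->
  smooth_fun U f -> smooth_fun U ('D_v f).
Proof.
move=> oU; elim => {f} [f g fg _ IH|c|f cf|f g sf IHf sg IHg|f g sf IHf sg IHg|f f0 sf IH|f f0 sf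
  IH].
- apply: smooth_fun_eq IH => x Ux; apply: near_eq_derive.
  by near=> y; apply: fg; near: y; exact: open_nbhs_nbhs.
- by apply: smooth_fun_eq (smooth_fun_cst _ 0) => x _; rewrite derive_cst.
- apply: smooth_fun_eq (smooth_fun_cst _ (f v)) => x _.
  by rewrite deriveE ?diff_lin //; exact: linear_differentiable.
- apply: smooth_fun_eq (smooth_funD IHf IHg) => x Ux.
  by rewrite deriveD //; apply: diff_derivable; exact: smooth_fun_differentiable Ux.
- apply: smooth_fun_eq (smooth_funD (smooth_funM sf IHg) (smooth_funM sg IHf)) => x Ux.
  by rewrite deriveM //; apply: diff_derivable; exact: smooth_fun_differentiable Ux.
- apply: smooth_fun_eq (smooth_funM (smooth_funM (smooth_fun_cst _ (-1))
     (smooth_funM (smooth_funV f0 sf) (smooth_funV f0 sf))) IH) => x Ux.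
  rewrite deriveV ?f0 //; last by apply: diff_derivable; exact: smooth_fun_differentiable Ux.
  by rewrite mulN1r -invfM -expr2.
- apply: smooth_fun_eq (smooth_funM (smooth_funV _
    (smooth_funM (smooth_fun_cst _ 2) (smooth_fun_sqrt f0 sf))) IH) => x Ux.
    by rewrite derive_sqrt_comp //; [exact: f0|exact: smooth_fun_differentiable Ux].
  by rewrite mulf_neq0 // gt_eqF // sqrtr_gt0 f0.
Unshelve. all: by end_near. Qed.

Lemma smooth_map_differentiable V W (U : set V) (f : V -> W) : open U ->
  smooth_map U f -> forall x, U x -> differentiable f x.
Proof.
move=> oU; elim => {f} [f g fg _ IH|a w sa|f g _ IHf _ IHg] x Ux.
- apply: near_eq_differentiable (IH _ Ux).
  by near=> y; apply: fg; near: y; exact: open_nbhs_nbhs.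
- exact/differentiableZl/(smooth_fun_differentiable oU).
- by apply: differentiableD; [exact: IHf|exact: IHg].
Unshelve. all: by end_near. Qed.

Lemma smooth_map_derive V W (U : set V) (f : V -> W) v : open U ->
  smooth_map U f -> smooth_map U ('D_v f).
Proof.
move=> oU; elim => {f} [f g fg _ IH|a w sa|f g sf IHf sg IHg].
- apply: smooth_map_eq IH => x Ux; apply: near_eq_derive.
  by near=> y; apply: fg; near: y; exact: open_nbhs_nbhs.
- apply: smooth_map_eq (smooth_mapZ _ (smooth_fun_derive v oU sa)) => x Ux.
  have da := smooth_fun_differentiable oU sa Ux.
  rewrite [RHS]deriveE ?diffZl -?deriveE //; exact: differentiableZl.
- apply: smooth_map_eq (smooth_mapD IHf IHg) => x Ux.
  by rewrite deriveD //; apply: diff_derivable; exact: smooth_map_differentiable Ux.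
Unshelve. all: by end_near. Qed.

Lemma smooth_map_C_on V W (U : set V) (f : V -> W) k : open U ->
  smooth_map U f -> C_on k U f.
Proof.
move=> oU; elim: k f => [|k IH] f sf /=.
  by move=> x Ux; apply: differentiable_continuous; exact: smooth_map_differentiable Ux.
split; first by move=> x Ux; exact: smooth_map_differentiable Ux.
by move=> v; apply: IH; exact: smooth_map_derive.
Qed.

Lemma smooth_map_smooth_on V W (A U : set V) (f : V -> W) : open U -> A `<=` U ->
  smooth_map U f -> smooth_on A f.
Proof.
by move=> oU AU sf p Ap; exists U, f; split => //; [exact: AU|move=> k; exact: smooth_map_C_on].
Qed.

Lemma smooth_fun_sub V (U U' : set V) (f : V -> R) : U `<=` U' ->
  smooth_fun U' f -> smooth_fun U f.
Proof.
move=> UU'; elim => {f} [f g fg _ IH|c|f cf|f g _ IHf _ IHg|f g _ IHf _ IHg|f f0 _ IH|f f0 _ IH].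
- by apply: smooth_fun_eq IH => x /UU'; exact: fg.
- exact: smooth_fun_cst.
- exact: smooth_fun_lin.
- exact: smooth_funD.
- exact: smooth_funM.
- by apply: smooth_funV => // x /UU'; exact: f0.
- by apply: smooth_fun_sqrt => // x /UU'; exact: f0.
Qed.

(** Precomposition with continuous linear maps covers the coordinate changes and projections used
    below; each constructor is compatible with it. *)
Lemma smooth_fun_linr V V' (L : {linear V' -> V}) (U : set V) (f : V -> R) :
  continuous L -> smooth_fun U f -> smooth_fun (L @^-1` U) (f \o L).
Proof.
move=> cL; elim => {f} [f g fg _ IH|c|f cf|f g _ IHf _ IHg|f g _ IHf _ IHg|f f0 _ IH|f f0 _ IH].
- by apply: smooth_fun_eq IH => x Ux; exact: fg.
- exact: smooth_fun_cst.
- apply: (@smooth_fun_lin _ _ (f \o L)) => x.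
  by apply: continuous_comp; [exact: cL|exact: cf].
- exact: smooth_funD.
- exact: smooth_funM.
- by apply: (@smooth_funV _ _ (f \o L)) => // x; exact: f0.
- by apply: (@smooth_fun_sqrt _ _ (f \o L)) => // x; exact: f0.
Qed.

Lemma smooth_map_linr V V' W (L : {linear V' -> V}) (U : set V) (f : V -> W) :
  continuous L -> smooth_map U f -> smooth_map (L @^-1` U) (f \o L).
Proof.
move=> cL; elim => {f} [f g fg _ IH|a w sa|f g _ IHf _ IHg].
- by apply: smooth_map_eq IH => x; exact: fg.
- by apply: (@smooth_mapZ _ _ _ (a \o L)); exact: smooth_fun_linr.
- exact: smooth_mapD.
Qed.

Lemma smooth_map_linl V W W' (L : {linear W -> W'}) (U : set V) (f : V -> W) :
  smooth_map U f -> smooth_map U (L \o f).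
Proof.
elim => {f} [f g fg _ IH|a w sa|f g _ IHf _ IHg].
- by apply: smooth_map_eq IH => x Ux /=; rewrite fg.
- by apply: smooth_map_eq (smooth_mapZ (L w) sa) => x _; rewrite /= linearZ.
- by apply: smooth_map_eq (smooth_mapD IHf IHg) => x _; rewrite /= linearD.
Qed.

Lemma smooth_fun_sum V (U : set V) (I : Type) (r : seq I) (P : pred I) (F : I -> V -> R) :
  (forall i, P i -> smooth_fun U (F i)) -> smooth_fun U (fun x => \sum_(i <- r | P i) F i x).
Proof.
move=> sF; elim: r => [|i r IH].
  by apply: smooth_fun_eq (smooth_fun_cst _ 0) => x _; rewrite big_nil.
case Pi: (P i); last by apply: smooth_fun_eq IH => x _; rewrite big_cons Pi.
by apply: smooth_fun_eq (smooth_funD (sF i Pi) IH) => x _; rewrite big_cons Pi.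
Qed.

Lemma smooth_map_sum V W (U : set V) (I : Type) (r : seq I) (F : I -> V -> W) :
  (forall i, smooth_map U (F i)) -> smooth_map U (fun x => \sum_(i <- r) F i x).
Proof.
move=> sF; elim: r => [|i r IH].
  apply: smooth_map_eq (smooth_mapZ 0 (smooth_fun_cst _ 0)) => x _.
  by rewrite big_nil scaler0.
by apply: smooth_map_eq (smooth_mapD (sF i) IH) => x _; rewrite big_cons.
Qed.

Lemma smooth_funN V (U : set V) (f : V -> R) : smooth_fun U f -> smooth_fun U (fun x => - f x).
Proof.
by move=> sf; apply: smooth_fun_eq (smooth_funM (smooth_fun_cst U (-1)) sf) => x _; rewrite mulN1r.
Qed.

Lemma smooth_map_mx V m n (U : set V) (f : V -> 'M[R]_(m, n)) :
  (forall i j, smooth_fun U (fun x => f x i j)) -> smooth_map U f.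
Proof.
move=> sf; apply: smooth_map_eq (smooth_map_sum (index_enum 'I_m) (fun i =>
  smooth_map_sum (index_enum 'I_n) (fun j => smooth_mapZ (delta_mx i j) (sf i j)))) => x _.
by rewrite [RHS]matrix_sum_delta.
Qed.

(** The pair is the sum of the images of [f] and [g] under the two linear injections into the
    product. *)
Lemma smooth_map_pair V W W' (U : set V) (f : V -> W) (g : V -> W') :
  smooth_map U f -> smooth_map U g -> smooth_map U (fun x => (f x, g x)).
Proof.
move=> sf sg.
have linl : linear (fun w : W => (w, 0 : W')).
  by move=> a x y; apply: injective_projections; rewrite /= ?scaler0 ?addr0.
have linr : linear (fun w : W' => (0 : W, w)).
  by move=> a x y; apply: injective_projections; rewrite /= ?scaler0 ?addr0.
pose Ll : {linear W -> (W * W')%type} := HB.pack (fun w : W => (w, 0 : W'))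
  (GRing.isLinear.Build _ _ _ _ _ linl).
pose Lr : {linear W' -> (W * W')%type} := HB.pack (fun w : W' => (0 : W, w))
  (GRing.isLinear.Build _ _ _ _ _ linr).
apply: smooth_map_eq (smooth_mapD (smooth_map_linl Ll sf) (smooth_map_linl Lr sg)) => x _.
by apply: injective_projections; rewrite /= ?addr0 ?add0r.
Qed.

Lemma smooth_map_fun V (U : set V) (f : V -> R) : smooth_fun U f -> smooth_map U f.
Proof.
move=> sf; apply: (@smooth_map_eq V R U (fun x => f x *: (1 : R))); last exact: smooth_mapZ.
by move=> x _; rewrite [LHS]mulr1.
Qed.

Lemma smooth_fun_coord m n (U : set 'M[R]_(m, n)) i j : smooth_fun U (fun M => M i j).
Proof.
have linf : linear (fun M : 'M[R]_(m, n) => M i j : R^o) by move=> a x y; rewrite !mxE.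
pose f : {linear 'M[R]_(m, n) -> R^o} := HB.pack (fun M : 'M[R]_(m, n) => M i j : R^o)
  (GRing.isLinear.Build _ _ _ _ _ linf).
exact: (@smooth_fun_lin _ _ f (@coord_continuous _ _ _ _ _)).
Qed.

(** * Open and closed sets cut out by smooth functions *)

Lemma smooth_fun_continuous V (f : V -> R) : smooth_fun setT f -> continuous f.
Proof.
move=> sf x; apply: differentiable_continuous.
exact: (smooth_fun_differentiable openT sf).
Qed.

Lemma open_smooth_gt0 V (f : V -> R) : smooth_fun setT f -> open [set x | 0 < f x].
Proof.
move=> /smooth_fun_continuous cf.
by apply: (@open_comp _ _ f [set r | 0 < r]) => [x _|]; [exact: cf|exact: open_gt].
Qed.

Lemma open_smooth_neq0 V (f : V -> R) : smooth_fun setT f -> open [set x | f x != 0].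
Proof.
move=> /smooth_fun_continuous cf.
by apply: (@open_comp _ _ f [set r | r != 0]) => [x _|]; [exact: cf|exact: open_neq].
Qed.

Lemma closed_smooth_eq V m n (f : V -> 'M[R]_(m, n)) M :
  (forall i j, smooth_fun setT (fun x => f x i j)) -> closed [set x | f x = M].
Proof.
move=> sf.
have -> : [set x | f x = M] =
    \bigcap_(ij in [set: 'I_m * 'I_n]) ((fun x => f x ij.1 ij.2) @^-1` [set M ij.1 ij.2]).
  apply/seteqP; split=> [x fx ij _|x H]; first by rewrite /preimage /= [f x]fx.
  by apply/matrixP => i j; exact: (H (i, j)).
apply: closed_bigI => -[i j] _ /=; apply: closed_comp => [x _|]; last exact: closed_eq.
exact: smooth_fun_continuous.
Qed.

(** Applying [L] to the expansion of the identity into matrix entries exhibits [L] itself as a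
    smooth map. *)
Lemma continuous_mx_lin m n W (L : {linear 'M[R]_(m, n) -> W}) : continuous L.
Proof.
have sL : smooth_map setT L.
  apply: smooth_map_eq (smooth_map_linl L (smooth_map_mx (fun i j =>
    @smooth_fun_coord m n setT i j))) => x _.
  by [].
move=> x; apply: differentiable_continuous.
exact: (smooth_map_differentiable openT sL).
Qed.

End SmoothFunctions.

(** * Submanifolds given locally as graphs over linear coordinates *)

Section GraphSubmanifold.
Context {R : realType}.

(** Membership in the slice as a fixed-point equation of the coordinate projection, the form in
    which it meets the rank normal form of a linear map. *)
Lemma slice_pid n d (z : 'rV[R]_n) : (d <= n)%N ->
  @slice R n d z <-> z *m (pid_mx d : 'M_(n, d)) *m (pid_mx d : 'M_(d, n)) = z.
Proof.
move=> dn; rewrite -mulmxA mul_pid_mx !minnn.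
have E : z *m (pid_mx d : 'M_n) = \row_j (if (j < d)%N then z 0 j else 0).
  apply/rowP => j; rewrite !mxE (bigD1 j) //= big1 => [|i /negPf ij].
    by rewrite mxE eqxx addr0 /=; case: ifP; rewrite (mulr0, mulr1).
  by rewrite mxE val_eqE ij mulr0.
rewrite E; split=> [sz|<- i di].
  apply/rowP => j; rewrite mxE; case: ltnP => // dj; by rewrite sz.
by rewrite mxE ltnNge di.
Qed.

(* With h x the difference between P x and a linear section of L, the shear y |-> y - h (L y)
   preserves L, has inverse y |-> y + h (L y), and maps M locally onto the image of the section. *)
Lemma graph_submanifold m n d (M : set 'M[R]_(m, n)) : (d <= m * n)%N ->
  (forall p, M p -> exists (L : {linear 'M[R]_(m, n) -> 'rV[R]_d})
      (s P : 'rV[R]_d -> 'M[R]_(m, n)) (D : set 'rV[R]_d) (U : set 'M[R]_(m, n)),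
    [/\ cancel s L, open D /\ open U, D (L p) /\ U p, smooth_map D P &
      (forall x, D x -> L (P x) = x) /\
      (forall y, U y -> D (L y) -> M y <-> P (L y) = y)]) ->
  smooth_submanifold (m * n) d M.
Proof.
move=> dmn HM; split=> // p Mp.
have [L [s [P [D [U0 [sK [oD oU0] [Dp Up] sP [LP MP]]]]]]] := HM p Mp.
pose A : 'M[R]_(m * n, d) := lin1_mx (L \o vec_mx).
have AE y : mxvec y *m A = L y by rewrite mul_rV_lin1 /= mxvecK.
(* The right inverse [s] makes [L] surjective, so its matrix has rank d. *)
have rA : \rank A = d.
  apply/eqP; apply/row_fullP; exists (\matrix_i mxvec (s (delta_mx 0 i))).
  by apply/row_matrixP => i; rewrite row_mul rowK AE sK row1.
(* In the coordinates [mxvec y *m C] the map [L] takes the first d entries and applies [E]. *)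
pose C := col_ebase A; pose E := row_ebase A.
have AC : A = C *m (pid_mx d : 'M_(m * n, d)) *m E by rewrite -{1}(mulmx_ebase A) rA.
have uC : C \in unitmx by exact: col_ebase_unit.
have uE : E \in unitmx by exact: row_ebase_unit.
(* A linear section of [L], with values in the slice once read in the coordinates given by [C]. *)
pose t (x : 'rV[R]_d) : 'M[R]_(m, n) :=
  vec_mx (x *m invmx E *m (pid_mx d : 'M_(d, m * n)) *m invmx C).
have pidK : (pid_mx d : 'M_(d, m * n)) *m (pid_mx d : 'M_(m * n, d)) = 1%:M :> 'M[R]_d.
  by rewrite mul_pid_mx !minnn (minn_idPr dmn) pid_mx_1.
have Lt x : L (t x) = x.
  rewrite -AE /t vec_mxK AC !mulmxA mulmxKV //.
  by rewrite -(mulmxA (x *m _)) pidK mulmx1 mulmxKV.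
pose h x := P x - t x.
have Lh x : D x -> L (h x) = 0 by move=> Dx; rewrite linearB LP // Lt subrr.
pose q z : 'M[R]_(m, n) := vec_mx (z *m invmx C).
have Lq z : L (q z) = z *m (pid_mx d : 'M_(m * n, d)) *m E.
  by rewrite -AE vec_mxK AC !mulmxA mulmxKV.
(* [f] is the shear followed by the linear coordinates that [q] inverts; [g] undoes both. *)
pose f y := mxvec (y - h (L y)) *m C.
pose g z := q z + h (L (q z)).
have lq : linear q by move=> a x y; rewrite /q mulmxDl -scalemxAl linearP.
pose qL : {linear 'rV[R]_(m * n) -> 'M[R]_(m, n)} := HB.pack q
  (GRing.isLinear.Build _ _ _ _ _ lq).
have lt : linear t.
  by move=> a x y; rewrite /t !mulmxDl -!scalemxAl linearP.
pose tL : {linear 'rV[R]_d -> 'M[R]_(m, n)} := HB.pack t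
  (GRing.isLinear.Build _ _ _ _ _ lt).
have lr : linear (fun y : 'M[R]_(m, n) => mxvec y *m C).
  by move=> a x y; rewrite linearP mulmxDl -scalemxAl.
pose rL : {linear 'M[R]_(m, n) -> 'rV[R]_(m * n)} := HB.pack (fun y : 'M[R]_(m, n) => mxvec y *m C)
  (GRing.isLinear.Build _ _ _ _ _ lr).
have sid k l (S : set 'M[R]_(k, l)) : smooth_map S id.
  by apply: smooth_map_mx => i j; exact: smooth_fun_coord.
have sh : smooth_map D h.
  apply: smooth_mapD => //.
  apply: smooth_map_eq (smooth_map_linl (\- tL)%R (sid _ _ D)) => x _ //.
have sf : smooth_map (L @^-1` D) f.
  apply: (smooth_map_linl rL); apply: smooth_mapD; first exact: sid.
  have /(smooth_map_linl (\- idfun)%R) := smooth_map_linr (@continuous_mx_lin _ _ _ _ L) sh.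
  by apply: smooth_map_eq.
have sg : smooth_map (qL @^-1` (L @^-1` D)) g.
  apply: smooth_mapD; first exact: (smooth_map_linl qL (sid _ _ _)).
  have := smooth_map_linr (@continuous_mx_lin _ _ _ _ qL) (smooth_map_linr (@continuous_mx_lin _
    _ _ _ L) sh).
  by apply: smooth_map_eq.
have oLD : open (L @^-1` D) by apply: open_comp => // x _; exact: continuous_mx_lin.
have oqD : open (qL @^-1` (L @^-1` D)) by apply: open_comp => // x _; exact: continuous_mx_lin.
have qf y : D (L y) -> q (f y) = y - h (L y).
  by move=> Dy; rewrite /q /f mulmxK // mxvecK.
have fK y : D (L y) -> L (q (f y)) = L y /\ g (f y) = y.
  move=> Dy; rewrite /g qf //.
  have E1 : L (y - h (L y)) = L y by rewrite linearB Lh // subr0.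
  by rewrite E1 subrK.
have gK z : D (L (q z)) -> L (g z) = L (q z) /\ f (g z) = z.
  move=> Dz.
  have E1 : L (g z) = L (q z) by rewrite /g linearD Lh // addr0.
  by rewrite /f E1 /g addrK /q vec_mxK mulmxKV.
exists (U0 `&` L @^-1` D), (qL @^-1` (L @^-1` D) `&` g @^-1` U0), f, g.
have oU : open (U0 `&` L @^-1` D) by exact: openI.
have oO : open (qL @^-1` (L @^-1` D) `&` g @^-1` U0).
  rewrite openE => z [Dz Uz]; apply: filterI; first exact: open_nbhs_nbhs.
  apply: (differentiable_continuous (smooth_map_differentiable oqD sg Dz)).
  exact: open_nbhs_nbhs.
split=> //.
  split.
  - by apply: (smooth_map_smooth_on oLD _ sf) => // y [].
  - by apply: (smooth_map_smooth_on oqD _ sg) => // y [].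
  - by move=> y [Uy Dy]; have [E1 E2] := fK y Dy; rewrite /preimage /= E1 E2.
  - by move=> z [Dz Uz]; have [E1 E2] := gK z Dz; rewrite /preimage /= E1 E2.
apply/seteqP; split=> [_ [y [My [Uy Dy]] <-]|z [[Dz Uz] /slice_pid - /(_ dmn) sz]].
  have [E1 E2] := fK y Dy; split; first by rewrite /preimage /= E1 E2.
  apply/slice_pid => //.
  (* A point of [M] equals [P (L y)], so the shear moves it to [t (L y)]. *)
  have /MP -/(_ Dy) [/(_ My) Py _] := Uy.
  have -> : f y = L y *m invmx E *m (pid_mx d : 'M_(d, m * n)).
    by rewrite /f /h Py opprB addrC subrK /t vec_mxK mulmxKV.
  by rewrite -(mulmxA (L y *m invmx E)) pidK mulmx1.
have [E1 E2] := gK z Dz; exists (g z) => //; split; last by rewrite /preimage /= E1.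
apply/MP => //; first by rewrite E1.
rewrite E1 /g /h.
(* For z in the slice, [q z] is a value of the linear section, so [g z] reduces to [P (L (q z))]. *)
have -> : t (L (q z)) = q z by rewrite Lq /t mulmxK // sz.
by rewrite addrC subrK.
Qed.

End GraphSubmanifold.

(** * Algebraic classification *)

Section Classification.
Context {R : realType}.
Implicit Types (A B C D M : 'M[R]_3) (u v w : 'rV[R]_3) (x y : 'cV[R]_3) (i j : 'I_3).

(** * Cyclic index arithmetic in dimension three *)

Lemma ord3_11 i : i + 1 + 1 = i + 2. Proof. by rewrite -addrA. Qed.
Lemma ord3_12 i : i + 1 + 2 = i.
Proof. by case: i => -[|[|[|//]]] ?; apply/val_inj. Qed.
Lemma ord3_21 i : i + 2 + 1 = i.
Proof. by case: i => -[|[|[|//]]] ?; apply/val_inj. Qed.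
Lemma ord3_22 i : i + 2 + 2 = i + 1.
Proof. by case: i => -[|[|[|//]]] ?; apply/val_inj. Qed.
Definition ord3E := (ord3_11, ord3_12, ord3_21, ord3_22).

Lemma ord3_eq1 i : (i + 1 == i) = false.
Proof. by case: i => -[|[|[|//]]] ?. Qed.
Lemma ord3_eq2 i : (i + 2 == i) = false.
Proof. by case: i => -[|[|[|//]]] ?. Qed.
Lemma ord3_eq12 i : (i + 1 == i + 2) = false.
Proof. by case: i => -[|[|[|//]]] ?. Qed.
Lemma ord3_eq21 i : (i + 2 == i + 1) = false.
Proof. by case: i => -[|[|[|//]]] ?. Qed.
Lemma ord3_eq1s i : (i == i + 1) = false. Proof. by rewrite eq_sym ord3_eq1. Qed.
Lemma ord3_eq2s i : (i == i + 2) = false. Proof. by rewrite eq_sym ord3_eq2. Qed.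
Definition ord3_eqE := (ord3_eq1, ord3_eq2, ord3_eq12, ord3_eq21, ord3_eq1s, ord3_eq2s, eqxx).

(** Cases are counted from an arbitrary base index, so that one cyclically symmetric computation
    treats all rows at once. *)
Lemma ord3_ind i (P : 'I_3 -> Prop) : P i -> P (i + 1) -> P (i + 2) -> forall j, P j.
Proof.
move=> P0 P1 P2 j.
have [->//|[->//|->//]] : j = i \/ j = i + 1 \/ j = i + 2.
case: i j {P0 P1 P2} => -[|[|[|//]]] ? [[|[|[|//]]] ?];
  by [left; apply/val_inj|right; left; apply/val_inj|right; right; apply/val_inj].
Qed.

Lemma sum3 (V : zmodType) (F : 'I_3 -> V) i : \sum_j F j = F i + F (i + 1) + F (i + 2).
Proof.
rewrite (bigD1 i) //= (bigD1 (i + 1)) ?ord3_eqE //= (bigD1 (i + 2)) ?ord3_eqE //=.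
rewrite big1 ?addr0; first exact: addrA.
by move=> j; move: j; apply: (@ord3_ind i); rewrite !ord3_eqE ?andbF.
Qed.

(** Evaluates the Kronecker deltas [x *+ (i == j)] coming from scalar matrices. *)
Lemma mulr_bool (x : R) : (x *+ true = x) * (x *+ false = 0). Proof. by []. Qed.

(** * Cofactor matrices, cross products and axial vectors *)

(** Cyclic indices absorb the signs (-1)^(i+j) of the usual cofactors. *)
Definition cofmx A : 'M[R]_3 :=
  \matrix_(i, j) (A (i + 1) (j + 1) * A (i + 2) (j + 2) - A (i + 2) (j + 1) * A (i + 1) (j + 2)).

(** Matrix of the cross product with [u]; the bracket of su(2) is the cross product. *)
Definition crossmx u : 'M[R]_3 := \matrix_(i, j)
  (if j == i + 2 then u 0 (i + 1) else if j == i + 1 then - u 0 (i + 2) else 0).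

(** The vector whose cross product matrix is the antisymmetric part of [A]. *)
Definition axial A : 'rV[R]_3 := \row_i ((A (i + 2) (i + 1) - A (i + 1) (i + 2)) / 2).

Lemma crossmxE u i : (crossmx u i i = 0) * (crossmx u i (i + 1) = - u 0 (i + 2)) * (crossmx u i
  (i + 2) = u 0 (i + 1)).
Proof. by rewrite !mxE !ord3_eqE. Qed.

Lemma crossmx_mul u x : crossmx u *m x = su2_bracket u^T x.
Proof.
apply/colP => i; rewrite mxE (sum3 _ i) !mxE !ord3_eqE.
by ring.
Qed.

Lemma su2_bracket_mul A x y : su2_bracket (A *m x) (A *m y) = cofmx A *m su2_bracket x y.
Proof.
apply/colP => i; rewrite !mxE !(sum3 _ i) !mxE !ord3E; ring.
Qed.

(** This is [su2_bracket_mul] for the matrix 1 + e A, to first order in e. *)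
Lemma su2_bracket_trace A x y : su2_bracket (A *m x) y + su2_bracket x (A *m y) =
  ((\tr A)%:M - A^T) *m su2_bracket x y.
Proof.
apply/colP => i; rewrite !mxE !(sum3 _ i) !mxE !ord3E !ord3_eqE !mulr_bool /mxtrace (sum3 _ i);
  ring.
Qed.

(** Brackets of two basis vectors give the third one up to sign, so brackets span the space. *)
Lemma mul_su2_bracket_eq0 n (M : 'M[R]_(n, 3)) :
  (forall x y, M *m su2_bracket x y = 0) -> M = 0.
Proof.
move=> M0; apply/matrixP => k i.
have := congr1 (fun z : 'cV_n => z k 0) (M0 (delta_mx (i + 1) 0) (delta_mx (i + 2) 0)).
rewrite !mxE (sum3 _ i) !mxE !ord3E !ord3_eqE /= => <-; ring.
Qed.

(** Cayley-Hamilton written for the adjugate, the transpose of the cofactor matrix. *)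
Lemma trmx_cofmx A : (cofmx A)^T = A *m A - \tr A *: A + ((\tr A ^+ 2 - \tr (A *m A)) / 2)%:M.
Proof.
apply/matrixP => i; apply: (@ord3_ind i);
  rewrite !mxE /mxtrace !(sum3 _ i) !mxE !(sum3 _ i) ?ord3E ?ord3_eqE ?mulr_bool; by field.
Qed.

(** The scalar is det A, expanded along the first column. *)
Lemma mul_trmx_cofmx A : A^T *m cofmx A = (\sum_i A i 0 * cofmx A i 0)%:M.
Proof.
rewrite (sum3 _ 0).
apply/matrixP => i j; move: i j; do 2 (apply: (@ord3_ind 0));
  rewrite !mxE !(sum3 _ 0) !mxE ?ord3E ?ord3_eqE ?mulr_bool; ring.
Qed.

Lemma mul_cofmx_tr A : A *m (cofmx A)^T = (\sum_i A i 0 * cofmx A i 0)%:M.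
Proof.
rewrite (sum3 _ 0).
apply/matrixP => i j; move: i j; do 2 (apply: (@ord3_ind 0));
  rewrite !mxE !(sum3 _ 0) !mxE ?ord3E ?ord3_eqE ?mulr_bool; ring.
Qed.

(** * Traces, rank one factors and the shape of single blocks *)

Lemma mxtraceN n (M : 'M[R]_n) : \tr (- M) = - \tr M. Proof. exact: raddfN. Qed.

(** The trace is the sum of the squares of the entries; over the reals this turns trace computations
    into matrix identities. *)
Lemma mxtrace_mul_tr_eq0 m n (M : 'M[R]_(m, n)) : \tr (M^T *m M) = 0 -> M = 0.
Proof.
have H (j : 'I_n) : \sum_i M i j ^+ 2 >= 0 by apply: sumr_ge0 => i _; exact: sqr_ge0.
have -> : \tr (M^T *m M) = \sum_j \sum_i M i j ^+ 2.
  by apply: eq_bigr => j _; rewrite !mxE; apply: eq_bigr => i _; rewrite mxE expr2.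
move=> /eqP; rewrite psumr_eq0 // => /allP M0.
apply/matrixP => i j; rewrite mxE.
have /= := M0 j (mem_index_enum _); rewrite psumr_eq0 => [/allP/(_ i (mem_index_enum _))|k _].
  by rewrite /= sqrf_eq0 => /eqP.
exact: sqr_ge0.
Qed.

(** Put M = tr(A) - A^T and e = det C; then C^T C M = e. If e = 0, then cof C = C M has vanishing
    Frobenius norm. Otherwise M is a multiple of the inverse of a symmetric matrix, whence A is
    symmetric and the first equation yields a contradiction. *)
Lemma torsion_singular A C :
  cofmx A = 1%:M + \tr A *: A - A *m A^T ->
  cofmx C = C *m ((\tr A)%:M - A^T) -> cofmx C = 0.
Proof.
set t := \tr A => NA NC.
set M := t%:M - A^T in NC *.
pose e := \sum_i C i 0 * cofmx C i 0.
have SM : C^T *m C *m M = e%:M by rewrite -mulmxA -NC mul_trmx_cofmx.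
have [e0|e0] := eqVneq e 0.
  by rewrite NC; apply: mxtrace_mul_tr_eq0; rewrite trmx_mul -mulmxA (mulmxA _ C) SM e0 raddf0
    mulmx0 raddf0.
have MT : M^T = M.
  have : M^T *m (C^T *m C *m M) = (C^T *m C *m M)^T *m M.
    by rewrite !trmx_mul trmxK !mulmxA.
  by rewrite SM tr_scalar_mx mul_scalar_mx mul_mx_scalar => /(scalerI e0).
have AT : A^T = A.
  by move: MT; rewrite /M linearB /= tr_scalar_mx trmxK => /addrI /oppr_inj.
have cT := trmx_cofmx A.
set s := (_ / 2) in cT.
pose d := \sum_i A i 0 * cofmx A i 0.
have dE := mul_cofmx_tr A; rewrite -/d in dE.
have dE' := dE; rewrite cT in dE'.
have NA' : (cofmx A)^T = 1%:M + t *: A - A *m A.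
  by rewrite NA AT linearB linearD linearZ /= trmx_mul AT tr_scalar_mx.
rewrite NA' in dE.
(* The trace of cof A is s by Cayley-Hamilton and 3 + 2 s by the torsion equation. *)
have sE : s = -3.
  have := congr1 mxtrace cT; rewrite NA' !mxtraceD !mxtraceN !mxtraceZ !mxtrace_scalar -/t.
  have -> : \tr (A *m A) = t ^+ 2 - 2 * s by rewrite /s; field.
  lra.
(* Here [dE] is the torsion equation times A, and [dE'] is Cayley-Hamilton. *)
have AE : A = (- d)%:M.
  (* In the sum the powers A^2 and A^3 cancel and (1 + s) A = 2 d remains. *)
  have := congr2 +%R dE dE'.
  rewrite !mulmxDr !mulmxN mulmx1 mul_mx_scalar sE -!scalemxAr.
  move=> /(congr1 (fun Z => (- 2^-1) *: Z)) E.
  apply/matrixP => i j; have := congr1 (fun Z : 'M_3 => Z i j) E; rewrite !mxE.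
  case: (i == j); rewrite ?mulr1n ?mulr0n; lra.
(* For A = -d the definition of s gives 3 d^2, which is nonnegative. *)
suff : s = 3 * d ^+ 2 by move=> s3; exfalso; have := sqr_ge0 d; lra.
by rewrite /s /t AE mul_scalar_mx mxtraceZ mxtrace_scalar; field.
Qed.

(** All 2 x 2 minors vanish, so a nonzero entry C_ij determines the rest by C_kl = C_kj C_il / C_ij.
    The normalised row i serves as [u], and its norm goes into [p]. *)
Lemma rank1_factor C : cofmx C = 0 -> C != 0 ->
  exists (p : 'cV[R]_3) (u : 'rV[R]_3), u *m u^T = 1%:M /\ C = p *m u.
Proof.
move=> C0 /eqP Cn0.
have [i [j Cij]] : exists i j, C i j != 0.
  apply: contrapT => H; apply: Cn0; apply/matrixP => i j; rewrite mxE.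
  by apply/eqP; apply: contraT => Cij; case: H; exists i, j.
have minor k l : C k l * C i j = C k j * C i l.
  have c0 a b := congr1 (fun Z : 'M_3 => Z a b) C0.
  move: k l; apply: (@ord3_ind i); apply: (@ord3_ind j); try ring.
  - by have := c0 (i + 2) (j + 2); rewrite !mxE !ord3E; lra.
  - by have := c0 (i + 2) (j + 1); rewrite !mxE !ord3E; lra.
  - by have := c0 (i + 1) (j + 2); rewrite !mxE !ord3E; lra.
  - by have := c0 (i + 1) (j + 1); rewrite !mxE !ord3E; lra.
pose n := \sum_l C i l ^+ 2.
have n0 : 0 < n.
  rewrite /n (bigD1 j) //= ltr_pwDl ?exprn_even_gt0 //.
  by apply: sumr_ge0 => k _; exact: sqr_ge0.
have r0 : Num.sqrt n != 0 by rewrite gt_eqF // sqrtr_gt0.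
exists ((Num.sqrt n / C i j) *: col j C), ((Num.sqrt n)^-1 *: row i C); split.
  rewrite linearZ /= -scalemxAl -scalemxAr scalerA.
  have -> : row i C *m (row i C)^T = n%:M.
    by apply/matrixP => a b; rewrite !mxE (ord1 a) (ord1 b) mulr1n; apply: eq_bigr => l _;
      rewrite !mxE expr2.
  rewrite -invfM -expr2 sqr_sqrtr ?ltW // -scalemx1 scalerA mulVf ?scale1r //.
  by rewrite gt_eqF.
apply/matrixP => k l; rewrite mxE big_ord1 !mxE.
have -> : C k l = C k j * C i l / C i j by rewrite -minor mulfK.
by field; rewrite r0 Cij.
Qed.

(** The symmetric part of A is forced to be tr(A) u^T u, which leaves A = tr(A) u^T u + [k]x with k
    axial. Then A u = tr(A) u makes k parallel to u, and the trace of A^2 gives |k| = 1, hence u = k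
    or u = -k. Unlike u, whose sign is arbitrary, k is a function of A. *)
Lemma axial_form A u :
  cofmx A = 1%:M + \tr A *: A - A *m A^T ->
  A *m u^T = \tr A *: u^T -> u *m u^T = 1%:M -> \tr (A *m A) = \tr A ^+ 2 - 2 ->
  [/\ axial A *m (axial A)^T = 1%:M,
      A = \tr A *: ((axial A)^T *m axial A) + crossmx (axial A) &
      exists2 e : R, e ^+ 2 = 1 & u = e *: axial A].
Proof.
set t := \tr A => NA Au uu trAA.
(* Here tr(cof A) = 1 by Cayley-Hamilton, and the torsion equation expresses it through tr(A
   A^T). *)
have tAT : \tr (A *m A^T) = t ^+ 2 + 2.
  have := congr1 mxtrace (trmx_cofmx A); rewrite mxtrace_tr NA.
  rewrite !mxtraceD !mxtraceN !mxtraceZ !mxtrace_scalar trAA -/t.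
  lra.
have uAu : u *m A *m u^T = t%:M by rewrite -mulmxA Au -scalemxAr uu scalemx1.
(* The squared Frobenius norm of the difference of the two sides is a combination of tr (A A),
   tr (A A^T) and u A u^T, and vanishes. *)
have S0 : A + A^T = (2 * t) *: (u^T *m u).
  apply/eqP; rewrite -subr_eq0; apply/eqP.
  set S := _ - _.
  have ST : S^T = S by rewrite /S linearB linearD linearZ /= trmxK trmx_mul trmxK [A^T + _]addrC.
  apply: mxtrace_mul_tr_eq0; rewrite ST /S.
  set U := u^T *m u.
  have UU : U *m U = U by rewrite /U mulmxA -(mulmxA u^T) uu mulmx1.
  have AU : A *m U = t *: U by rewrite /U mulmxA Au -scalemxAl.
  have UT : U^T = U by rewrite /U trmx_mul trmxK.
  have UA : U *m A^T = t *: U by rewrite -[LHS]trmxK trmx_mul trmxK UT AU linearZ /= UT.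
  have trU : \tr U = 1 by rewrite /U mxtrace_mulC uu mxtrace_scalar.
  rewrite !(mulmxDl, mulmxDr, mulmxN, mulNmx) -?scalemxAl -?scalemxAr.
  rewrite !(mxtraceD, mxtraceN, mxtraceZ) UU AU UA.
  rewrite (mxtrace_mulC A^T A) (mxtrace_mulC A^T U) (mxtrace_mulC U A) UA AU -trmx_mul mxtrace_tr.
  rewrite tAT trAA !mxtraceZ trU; ring.
set k := axial A; set U := u^T *m u in S0.
have AE : A = t *: U + crossmx k.
  apply/matrixP => i; have S0e j := congr1 (fun Z : 'M_3 => Z i j) S0.
  apply: (@ord3_ind i).
  - by have := S0e i; clearbody U; rewrite !mxE !ord3_eqE; lra.
  - by have := S0e (i + 1); clearbody U; rewrite !mxE !ord3_eqE !ord3E; lra.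
  - by have := S0e (i + 2); clearbody U; rewrite !mxE !ord3_eqE !ord3E; lra.
clearbody k.
have Uu : U *m u^T = u^T by rewrite /U -mulmxA uu mulmx1.
have Ku : crossmx k *m u^T = 0.
  by have := Au; rewrite {1}AE mulmxDl -scalemxAl Uu => /(canRL (addKr _)); rewrite addNr.
have kk : \sum_i k 0 i ^+ 2 = 1.
  have : \tr (A *m A) = t ^+ 2 - 2 * \sum_i k 0 i ^+ 2.
    have UU : U *m U = U by rewrite {2}/U mulmxA Uu.
    have KU : crossmx k *m U = 0 by rewrite /U mulmxA Ku mul0mx.
    have UK : \tr (U *m crossmx k) = 0 by rewrite mxtrace_mulC KU raddf0.
    have trU : \tr U = 1 by rewrite /U mxtrace_mulC uu mxtrace_scalar.
    have KK : \tr (crossmx k *m crossmx k) = - 2 * \sum_i k 0 i ^+ 2.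
      by rewrite /mxtrace !(sum3 _ 0) !mxE !(sum3 _ 0) !mxE !ord3E !ord3_eqE; ring.
    rewrite {1 2}AE !(mulmxDl, mulmxDr) -?scalemxAl -?scalemxAr KU UU.
    by rewrite !(mxtraceD, mxtraceZ) UK trU KK raddf0; ring.
  rewrite trAA; lra.
(* Being parallel to the unit vector k, u equals its projection (u . k) k. *)
pose e := \sum_i u 0 i * k 0 i.
have uE : u = e *: k.
  apply/rowP => i; rewrite mxE -[LHS]mulr1 -kk /e !(sum3 _ i).
  have K j := congr1 (fun Z : 'cV_3 => Z j 0) Ku.
  have := K (i + 1); have := K (i + 2); have := K i.
  rewrite !mxE !(sum3 _ i) !crossmxE ![crossmx k _ _]mxE !ord3E !ord3_eqE ![u^T _ _]mxE => K0 K2 K1.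
  have {}K1 : u 0 i * k 0 (i + 2) = u 0 (i + 2) * k 0 i by lra.
  have {}K2 : u 0 i * k 0 (i + 1) = u 0 (i + 1) * k 0 i by lra.
  rewrite !mulrDr !expr2 !mulrA K1 K2; ring.
have kkm : k *m k^T = 1%:M.
  apply/matrixP => a b; rewrite !mxE (ord1 a) (ord1 b) -[RHS]kk.
  by apply: eq_bigr => i _; rewrite mxE expr2.
have ee : e ^+ 2 = 1.
  have := congr1 mxtrace uu; rewrite uE linearZ /= -scalemxAl -scalemxAr scalerA kkm.
  by rewrite mxtraceZ !mxtrace_scalar mulr1.
split=> //; last by exists e.
have UE : U = k^T *m k.
  by rewrite /U uE [(e *: k)^T]linearZ /= -scalemxAl -scalemxAr scalerA -expr2 ee scale1r.
by rewrite {1}AE UE.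
Qed.

(* [3 + 3] and [6] are convertible but not syntactically equal, which makes block rewriting fail. *)
Definition col6 (x1 x2 : 'cV[R]_3) : 'cV[R]_6 := @col_mx R 3 3 1 x1 x2.
Definition block6 A B C D : 'M[R]_6 := @block_mx R 3 3 3 3 A B C D.

Lemma col6P (X : 'cV[R]_6) : exists x1 x2, X = col6 x1 x2.
Proof. by exists (@usubmx R 3 3 1 X), (@dsubmx R 3 3 1 X); rewrite /col6 vsubmxK. Qed.

Lemma block6P (J : 'M[R]_6) : exists A B C D, J = block6 A B C D.
Proof.
exists (@ulsubmx R 3 3 3 3 J), (@ursubmx R 3 3 3 3 J), (@dlsubmx R 3 3 3 3 J),
  (@drsubmx R 3 3 3 3 J).
by rewrite /block6 submxK.
Qed.

Lemma col6B (x1 x2 y1 y2 : 'cV[R]_3) : col6 x1 x2 - col6 y1 y2 = col6 (x1 - y1) (x2 - y2).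
Proof. by rewrite /col6 -[LHS]/(@col_mx R 3 3 1 x1 x2 - col_mx y1 y2) opp_col_mx add_col_mx. Qed.

Lemma col6_eq0 (x1 x2 : 'cV[R]_3) : col6 x1 x2 = 0 <-> x1 = 0 /\ x2 = 0.
Proof.
have <- : col6 0 0 = 0 by exact: (@col_mx0 R 3 3 1).
by split=> [E|[-> ->]//]; exact: (@eq_col_mx R 3 3 1 _ _ _ _ E).
Qed.

Lemma mul_block6_col6 A B C D (x1 x2 : 'cV[R]_3) :
  block6 A B C D *m col6 x1 x2 = col6 (A *m x1 + B *m x2) (C *m x1 + D *m x2).
Proof. exact: (@mul_block_col _ 3 3 3 3 1). Qed.

Lemma mul_block6 A B C D A' B' C' D' : block6 A B C D *m block6 A' B' C' D' =
  block6 (A *m A' + B *m C') (A *m B' + B *m D') (C *m A' + D *m C') (C *m B' + D *m D').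
Proof. exact: (@mulmx_block _ 3 3 3 3 3 3). Qed.

Lemma block6_eqN1 A B C D : block6 A B C D = - 1%:M <->
  [/\ A = - 1%:M, B = 0, C = 0 & D = - 1%:M].
Proof.
have -> : - 1%:M = block6 (- 1%:M) 0 0 (- 1%:M).
  rewrite /block6 -[LHS]/(- (1%:M : 'M_(3 + 3))) (@scalar_mx_block _ 3 3) opp_block_mx.
  by rewrite !oppr0.
by split=> [E|[-> -> -> ->]//]; exact: (@eq_block_mx R 3 3 3 3 _ _ _ _ _ _ _ _ E).
Qed.

Lemma su2su2_bracket_col6 (x1 x2 y1 y2 : 'cV[R]_3) :
  su2su2_bracket (col6 x1 x2) (col6 y1 y2) = col6 (su2_bracket x1 y1) (su2_bracket x2 y2).
Proof. by rewrite /su2su2_bracket !col_mxKu !col_mxKd. Qed.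

Lemma complex_structure_block A B C D :
  complex_structure su2su2_bracket (block6 A B C D) <->
  [/\ A *m A + B *m C = - 1%:M, A *m B + B *m D = 0,
      C *m A + D *m C = 0 & C *m B + D *m D = - 1%:M] /\
  forall x1 x2 y1 y2 : 'cV[R]_3,
    let a1 := A *m x1 + B *m x2 in let a2 := C *m x1 + D *m x2 in
    let b1 := A *m y1 + B *m y2 in let b2 := C *m y1 + D *m y2 in
    su2_bracket a1 b1 - su2_bracket x1 y1
      - (A *m su2_bracket a1 y1 + B *m su2_bracket a2 y2)
      - (A *m su2_bracket x1 b1 + B *m su2_bracket x2 b2) = 0 /\
    su2_bracket a2 b2 - su2_bracket x2 y2
      - (C *m su2_bracket a1 y1 + D *m su2_bracket a2 y2)
      - (C *m su2_bracket x1 b1 + D *m su2_bracket x2 b2) = 0.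
Proof.
rewrite /complex_structure mul_block6 block6_eqN1.
split=> [[J2 N]|[J2 N]]; split=> //.
  move=> x1 x2 y1 y2 /=; have := N (col6 x1 x2) (col6 y1 y2).
  by rewrite !(mul_block6_col6, su2su2_bracket_col6, col6B) => /col6_eq0.
move=> X Y; have [x1 [x2 ->]] := col6P X; have [y1 [y2 ->]] := col6P Y.
by rewrite !(mul_block6_col6, su2su2_bracket_col6, col6B); apply/col6_eq0; exact: N.
Qed.

(* On the span of (u, 0) and (0, v) this acts by [[xi, -(xi^2 + 1)/eta], [eta, -xi]], and on the
   orthogonal complement by (x, y) |-> (u x x, v x y). *)
Definition cs_param (xi eta : R) u v : 'M[R]_6 :=
  block6 (xi *: (u^T *m u) + crossmx u) (- ((xi ^+ 2 + 1) / eta) *: (u^T *m v))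
           (eta *: (v^T *m u)) (- xi *: (v^T *m v) + crossmx v).

(** * Members of the explicit family are complex structures *)

Lemma sphereP u : unit_sphere u <-> u *m u^T = 1%:M.
Proof.
rewrite /unit_sphere /=; split=> [E|/(congr1 (fun Z : 'M_1 => Z 0 0))].
  apply/matrixP => a b; rewrite !mxE (ord1 a) (ord1 b) -[RHS]E.
  by apply: eq_bigr => i _; rewrite mxE expr2.
by rewrite !mxE eqxx mulr1n => <-; apply: eq_bigr => i _; rewrite mxE expr2.
Qed.

Lemma su2_bracket0l x : su2_bracket 0 x = 0.
Proof. by apply/colP => i; rewrite !mxE; ring. Qed.
Lemma su2_bracket0r x : su2_bracket x 0 = 0.
Proof. by apply/colP => i; rewrite !mxE; ring. Qed.

(** Each component of the image is a multiple of u plus a cross product with u; the coupling between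
    the two factors sits entirely in the scalar. *)
Lemma block_row_mul (a b : R) u v x y :
  (a *: (u^T *m u) + crossmx u) *m x + b *: (u^T *m v) *m y =
  (a * (u *m x) 0 0 + b * (v *m y) 0 0) *: u^T + su2_bracket u^T x.
Proof.
rewrite mulmxDl -!scalemxAl -!mulmxA crossmx_mul.
rewrite [u *m x]mx11_scalar [v *m y]mx11_scalar !mul_mx_scalar !mxE !eqxx !mulr1n.
by rewrite scalerDl !scalerA addrAC.
Qed.

(* The Jacobi identity gives u x (x x y) for this sum, which is orthogonal to u. *)
Lemma rotated_bracket_orthogonal u x y (s t : R) :
  u *m (su2_bracket (s *: u^T + su2_bracket u^T x) y
        + su2_bracket x (t *: u^T + su2_bracket u^T y)) = 0.
Proof.
apply/matrixP => k l; rewrite (ord1 k) (ord1 l) !mxE (sum3 _ 0) !mxE !ord3E; ring.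
Qed.

Lemma rotated_bracket_torsion u x y (s t : R) : unit_sphere u ->
  su2_bracket (s *: u^T + su2_bracket u^T x) (t *: u^T + su2_bracket u^T y)
  - su2_bracket x y
  = su2_bracket u^T (su2_bracket (s *: u^T + su2_bracket u^T x) y
        + su2_bracket x (t *: u^T + su2_bracket u^T y)).
Proof.
rewrite /unit_sphere /= => uu; apply/colP => i; rewrite (sum3 _ i) in uu.
(* Multiplying by |u|^2 = 1 makes both sides homogeneous of degree two in u, hence a polynomial
   identity. *)
set p := su2_bracket x y; have pE : p i 0 = (u 0 i ^+ 2 + u 0 (i + 1) ^+ 2 + u 0 (i + 2) ^+ 2) *
  p i 0.
  by rewrite uu mul1r.
rewrite mxE [(- p) _ _]mxE pE /p !mxE !ord3E; ring.
Qed.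

(** With arbitrary coefficients, one statement covers both components of the torsion: exchanging the
    two factors gives the second. The summands of [a2] are ordered so that [block_row_mul] applies
    to it as well. *)
Lemma block_torsion (a b c d : R) u v x1 x2 y1 y2 : unit_sphere u ->
  let A := a *: (u^T *m u) + crossmx u in let B := b *: (u^T *m v) in
  let C := c *: (v^T *m u) in let D := d *: (v^T *m v) + crossmx v in
  let a1 := A *m x1 + B *m x2 in let a2 := D *m x2 + C *m x1 in
  let b1 := A *m y1 + B *m y2 in let b2 := D *m y2 + C *m y1 in
  su2_bracket a1 b1 - su2_bracket x1 y1
    - (A *m su2_bracket a1 y1 + B *m su2_bracket a2 y2)
    - (A *m su2_bracket x1 b1 + B *m su2_bracket x2 b2) = 0.
Proof.
move=> uu A B C D a1 a2 b1 b2.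
(* [A] and [B] are applied to two sums of brackets, orthogonal to u and v respectively, so only the
   cross product with u survives. *)
rewrite -addrA -opprD addrACA -!mulmxDr /A /B block_row_mul.
rewrite /a1 /a2 /b1 /b2 /A /B /C /D !block_row_mul !rotated_bracket_orthogonal.
by rewrite !mxE !mulr0 addr0 scale0r add0r rotated_bracket_torsion // subrr.
Qed.

Lemma cs_param_complex_structure xi eta u v : eta != 0 ->
  unit_sphere u -> unit_sphere v -> complex_structure su2su2_bracket (cs_param xi eta u v).
Proof.
move=> e0 /sphereP uu /sphereP vv; apply/complex_structure_block; split.
  have UU (w w' : 'rV[R]_3) : w *m w^T = 1%:M -> forall w1 : 'rV[R]_3,
    w1^T *m w *m (w^T *m w') = w1^T *m w' :> 'M[R]_3.
    by move=> E w1; rewrite mulmxA -(mulmxA w1^T) E mulmx1.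
  have uK (w : 'rV[R]_3) : w *m crossmx w = 0.
    apply/rowP => i; rewrite !mxE (sum3 _ i) !mxE !ord3E !ord3_eqE; ring.
  have Ku (w : 'rV[R]_3) : crossmx w *m w^T = 0.
    by rewrite crossmx_mul; apply/colP => i; rewrite !mxE; ring.
  have KK (w : 'rV[R]_3) : w *m w^T = 1%:M -> crossmx w *m crossmx w = w^T *m w - 1%:M.
    move=> /sphereP; rewrite /unit_sphere /= => E.
    apply/matrixP => i; rewrite (sum3 _ i) in E; apply: (@ord3_ind i);
      rewrite !mxE ?(sum3 _ i) ?big_ord1 ?mxE ?ord3E ?ord3_eqE ?mulr_bool; (ring || (rewrite -E;
        ring)).
  have uKm (w w' : 'rV[R]_3) : w'^T *m w *m crossmx w = 0 by rewrite -mulmxA uK mulmx0.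
  have Kum (w w' : 'rV[R]_3) : crossmx w *m (w^T *m w') = 0 by rewrite mulmxA Ku mul0mx.
  split; rewrite !(mulmxDl, mulmxDr) -?scalemxAl -?scalemxAr !(UU _ _ uu,
    UU _ _ vv) ?uKm ?Kum ?KK //.
  - apply/matrixP => i j; rewrite !mxE; by field.
  - apply/matrixP => i j; rewrite !mxE; by field.
  - apply/matrixP => i j; rewrite !mxE; by field.
  - apply/matrixP => i j; rewrite !mxE; by field.
move=> x1 x2 y1 y2 /=; split.
  have := @block_torsion xi (- ((xi ^+ 2 + 1) / eta)) eta (- xi) u v x1 x2 y1 y2.
  by rewrite /= ![_ *m x2 + _ *m x1]addrC ![_ *m y2 + _ *m y1]addrC; apply; exact/sphereP.
(* The second component is the first one with the factors exchanged, that is with xi negated and the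
   two off-diagonal coefficients swapped. *)
have := @block_torsion (- xi) eta (- ((xi ^+ 2 + 1) / eta)) xi v u x2 x1 y2 y1.
rewrite /= ![_ *m x2 + _ *m x1]addrC ![_ *m y2 + _ *m y1]addrC.
rewrite [_ *m su2_bracket _ y2 + _]addrC [_ *m su2_bracket x2 _ + _]addrC.
by apply; exact/sphereP.
Qed.

(** * Every complex structure belongs to the family *)

(** Both conditions say that a fixed matrix kills every bracket of x and y, and brackets span. *)
Lemma torsion_cofactors A C : 
  (forall x y, su2_bracket (A *m x) (A *m y) - su2_bracket x y
     - A *m su2_bracket (A *m x) y - A *m su2_bracket x (A *m y) = 0) ->
  (forall x y, su2_bracket (C *m x) (C *m y)
     - C *m su2_bracket (A *m x) y - C *m su2_bracket x (A *m y) = 0) ->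
  cofmx A = 1%:M + \tr A *: A - A *m A^T /\ cofmx C = C *m ((\tr A)%:M - A^T).
Proof.
move=> NA NC; split; apply/eqP; rewrite -subr_eq0; apply/eqP; apply: mul_su2_bracket_eq0 => x y.
  rewrite -[RHS](NA x y) -[RHS]addrA -opprD -mulmxDr su2_bracket_trace su2_bracket_mul.
  by rewrite mulmxA mulmxBr mul_mx_scalar -[1%:M + _ - _]addrA mulmxBl mulmxDl mul1mx opprD addrA.
rewrite -[RHS](NC x y) -addrA -opprD -mulmxDr su2_bracket_trace su2_bracket_mul.
by rewrite mulmxBl mulmxA.
Qed.

(** In odd dimension det(-1) = -1, which is not a square. *)
Lemma sqrmx3_neqN1 A : A *m A <> - 1%:M.
Proof.
move=> /(congr1 determinant); rewrite det_mulmx -scaleN1r scalemx1 det_scalar -expr2.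
have := sqr_ge0 (\det A); lra.
Qed.

Lemma complex_structure_cs_param (J : 'M[R]_6) :
  complex_structure su2su2_bracket J -> exists xi eta u v,
  [/\ eta != 0, unit_sphere u, unit_sphere v & J = cs_param xi eta u v].
Proof.
have [A [B [C [D ->]]]] := block6P J => /complex_structure_block [[E1 E2 E3 E4] N].
have [NA NC] : cofmx A = 1%:M + \tr A *: A - A *m A^T /\ cofmx C = C *m ((\tr A)%:M - A^T).
  (* Pairs inside the first factor only see the blocks A and C. *)
  apply: torsion_cofactors => x y; have [] := N x 0 y 0;
    by rewrite /= !mulmx0 !addr0 !su2_bracket0l !su2_bracket0r !mulmx0 !addr0 ?subr0.
have [ND NB] : cofmx D = 1%:M + \tr D *: D - D *m D^T /\ cofmx B = B *m ((\tr D)%:M - D^T).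
  apply: torsion_cofactors => x y; have [] := N 0 x 0 y;
    by rewrite /= !mulmx0 !add0r !su2_bracket0l !su2_bracket0r !mulmx0 !add0r ?subr0.
have C0 := torsion_singular NA NC; have B0 := torsion_singular ND NB.
have Cn : C != 0.
  by apply/eqP => Cz; apply: (@sqrmx3_neqN1 A); rewrite -E1 Cz mulmx0 addr0.
have Bn : B != 0.
  by apply/eqP => Bz; apply: (@sqrmx3_neqN1 A); rewrite -E1 Bz mul0mx addr0.
have [p [u [uu CE]]] := rank1_factor C0 Cn.
have [r [v [vv BE]]] := rank1_factor B0 Bn.
(* The cofactors vanish, so z w (tr X - X^T) = 0 with z nonzero; hence w is a left null vector of tr
   X - X^T. *)
have eigen (X Y : 'M[R]_3) (z : 'cV[R]_3) (w : 'rV[R]_3) : w *m w^T = 1%:M ->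
    Y = z *m w -> Y != 0 -> cofmx Y = 0 -> cofmx Y = Y *m ((\tr X)%:M - X^T) ->
    X *m w^T = \tr X *: w^T.
  move=> ww -> zn -> /esym; rewrite -mulmxA; set q := w *m _ => zw0.
  have w0 : q = 0.
    apply: contraNeq zn => /rV0Pn [j wj]; apply/eqP.
    suff -> : z = 0 by rewrite mul0mx.
    apply/colP => i; rewrite mxE; apply/eqP.
    have := congr1 (fun Z : 'M_3 => Z i j) zw0; clearbody q; rewrite !mxE big_ord1 => /eqP.
    by rewrite mulf_eq0 (negPf wj) orbF.
  move: w0; rewrite /q mulmxBr mul_mx_scalar => /(congr1 trmx).
  by rewrite linearB linearZ /= trmx_mul trmxK linear0 => /subr0_eq.
have Au := eigen A C p u uu CE Cn C0 NC.
have Dv := eigen D B r v vv BE Bn B0 NB.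
set t := \tr A in Au NA; set s := \tr D in Dv ND.
have Cu : C *m u^T = p by rewrite CE -mulmxA uu mulmx1.
have Bv : B *m v^T = r by rewrite BE -mulmxA vv mulmx1.
(* J^2 = -1 carries the eigenvector u of A to the eigenvector C u of D, with the opposite
   eigenvalue. *)
have Dp : D *m p = - t *: p.
  have := congr1 (fun Z => Z *m u^T) E3; rewrite mul0mx mulmxDl -!mulmxA Cu Au -scalemxAr Cu.
  by move=> /eqP; rewrite addrC addr_eq0 scaleNr => /eqP.
have Ar : A *m r = - s *: r.
  have := congr1 (fun Z => Z *m v^T) E2; rewrite mul0mx mulmxDl -!mulmxA Bv Dv -scalemxAr Bv.
  by move=> /eqP; rewrite addr_eq0 scaleNr => /eqP.
have un0 : u != 0.
  by apply/eqP => u0; move: CE Cn; rewrite u0 mulmx0 => ->; rewrite eqxx.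
have vn0 : v != 0.
  by apply/eqP => v0; move: BE Bn; rewrite v0 mulmx0 => ->; rewrite eqxx.
(* Applied to w, the diagonal block of J^2 = -1 reads k^2 w + m q = -w, and k^2 + 1 > 0 makes q a
   nonzero multiple of w. *)
have colinear (X Y Z : 'M[R]_3) (q z : 'cV[R]_3) (w w' : 'rV[R]_3) (k : R) : w != 0 ->
    X *m w^T = k *: w^T -> X *m X + Y *m Z = - 1%:M -> Z *m w^T = z -> Y = q *m w' ->
    exists2 b, b != 0 & q = b *: w^T.
  move=> wn Xw XX Zw Yq.
  have := congr1 (fun Z => Z *m w^T) XX.
  rewrite mulmxDl -!mulmxA Xw -scalemxAr Xw Zw Yq mulNmx mul1mx scalerA -mulmxA.
  rewrite [w' *m z]mx11_scalar mul_mx_scalar; set m := (w' *m z) 0 0 => E.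
  have Eq : m *: q = - (k ^+ 2 + 1) *: w^T.
    by apply/(addrI ((k * k) *: w^T)); rewrite E -scalerDl expr2 opprD addrA addrN add0r scaleN1r.
  have k0 : k ^+ 2 + 1 != 0 by rewrite gt_eqF // ltr_wpDl // sqr_ge0.
  have wT : w^T != 0 by rewrite trmx_eq0.
  have m0 : m != 0.
    apply: contraNneq wT => m0; move: Eq; rewrite m0 scale0r => /esym/eqP.
    by rewrite scaler_eq0 oppr_eq0 (negPf k0).
  exists (m^-1 * - (k ^+ 2 + 1)); first by rewrite mulf_neq0 ?invr_eq0 ?oppr_eq0.
  by rewrite -scalerA -Eq scalerA mulVf // scale1r.
have [b bn rE] := colinear _ _ _ _ _ _ _ _ un0 Au E1 Cu BE.
have E4' : D *m D + C *m B = - 1%:M by rewrite addrC.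
have [c cn pE] := colinear _ _ _ _ _ _ _ _ vn0 Dv E4' Bv CE.
have scale_inj (w : 'rV[R]_3) (a a' : R) : w != 0 -> a *: w^T = a' *: w^T -> a = a'.
  move=> wn /eqP; rewrite -subr_eq0 -scalerBl scaler_eq0 trmx_eq0 (negPf wn) orbF subr_eq0.
  by move=> /eqP.
(* r is parallel to u, so the eigenvalues -s and t of A on the two agree. *)
have st : s = - t.
  have := Ar; rewrite rE -scalemxAr Au !scalerA => /(scale_inj _ _ _ un0) E.
  by apply: (mulfI bn); rewrite mulrN E; ring.
have BC : B *m C = (b * c) *: (u^T *m u).
  by rewrite BE CE rE pE -!scalemxAl -scalemxAr scalerA mulmxA -(mulmxA u^T) vv mulmx1.
have CB : C *m B = (b * c) *: (v^T *m v).
  by rewrite BE CE rE pE -!scalemxAl -scalemxAr scalerA mulmxA -(mulmxA v^T) uu mulmx1 mulrC.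
have bc : b * c = - (t ^+ 2 + 1).
  have := congr1 (fun Z => Z *m u^T) E1; rewrite mulmxDl -mulmxA Au -scalemxAr Au BC -scalemxAl
    -mulmxA.
  rewrite uu mulmx1 scalerA -scalerDl mulNmx mul1mx -scaleN1r => /(scale_inj _ _ _ un0).
  lra.
have trA : \tr (A *m A) = t ^+ 2 - 2.
  have := congr1 mxtrace E1; rewrite mxtraceD mxtraceN mxtrace_scalar BC mxtraceZ (mxtrace_mulC
    u^T) uu.
  rewrite mxtrace_scalar bc; lra.
have trD : \tr (D *m D) = s ^+ 2 - 2.
  have := congr1 mxtrace E4; rewrite mxtraceD mxtraceN mxtrace_scalar CB mxtraceZ (mxtrace_mulC
    v^T) vv.
  rewrite mxtrace_scalar bc st sqrrN; lra.
have [kk AE [e ee uE]] := axial_form NA Au uu trA.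
have [ll DE [e' ee' vE]] := axial_form ND Dv vv trD.
have en : e != 0 by apply: contra_eq_neq ee => ->; rewrite expr0n eq_sym oner_neq0.
have en' : e' != 0 by apply: contra_eq_neq ee' => ->; rewrite expr0n eq_sym oner_neq0.
(* The signs relating u and v to the axial vectors are absorbed into eta. *)
exists t, (c * e * e'), (axial A), (axial D); split.
- by rewrite !mulf_neq0.
- exact/sphereP.
- exact/sphereP.
have outer (a a' : R) (w w' : 'rV[R]_3) : (a *: w)^T *m (a' *: w') = (a * a') *: (w^T *m w').
  by rewrite [(a *: w)^T]linearZ /= -scalemxAl -scalemxAr scalerA.
rewrite /cs_param; congr block6.
- exact: AE.
- rewrite BE rE -scalemxAl uE vE outer scalerA; congr (_ *: _).
  have -> : t ^+ 2 + 1 = - (b * c) by rewrite bc opprK.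
  have eV : e^-1 = e by apply: (mulfI en); rewrite divff // -expr2 ee.
  have eV' : e'^-1 = e' by apply: (mulfI en'); rewrite divff // -expr2 ee'.
  by rewrite !invfM eV eV'; field.
- by rewrite CE pE -scalemxAl uE vE outer scalerA; congr (_ *: _); ring.
by rewrite {1}DE -/s st.
Qed.

End Classification.

(** * Topology of the set of complex structures *)

Section Topology.
Context {R : realType}.
Implicit Types (A B C D M : 'M[R]_3) (u v w : 'rV[R]_3) (i j a b : 'I_3).

(** * Reading the parameters off a matrix, smoothness of the family, closedness *)

Definition lshift6 i : 'I_6 := @lshift 3 3 i.
Definition rshift6 i : 'I_6 := @rshift 3 3 i.

Lemma ord6P (P : 'I_6 -> Prop) : (forall i, P (lshift6 i)) -> (forall i,
  P (rshift6 i)) -> forall k, P k.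
Proof. by move=> Pl Pr k; rewrite -(@fintype.splitK 3 3 k); case: (@fintype.split 3 3 k) => i;
  [exact: Pl|exact: Pr]. Qed.

Lemma block6E A B C D i j :
  (block6 A B C D (lshift6 i) (lshift6 j) = A i j) *
  (block6 A B C D (lshift6 i) (rshift6 j) = B i j) *
  (block6 A B C D (rshift6 i) (lshift6 j) = C i j) *
  (block6 A B C D (rshift6 i) (rshift6 j) = D i j).
Proof.
split; [split; [split|]|].
- exact: (@block_mxEul R 3 3 3 3).
- exact: (@block_mxEur R 3 3 3 3).
- exact: (@block_mxEdl R 3 3 3 3).
- exact: (@block_mxEdr R 3 3 3 3).
Qed.

Definition ulblock (J : 'M[R]_6) : 'M[R]_3 := \matrix_(i, j) J (lshift6 i) (lshift6 j).
Definition dlblock (J : 'M[R]_6) : 'M[R]_3 := \matrix_(i, j) J (rshift6 i) (lshift6 j).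
Definition drblock (J : 'M[R]_6) : 'M[R]_3 := \matrix_(i, j) J (rshift6 i) (rshift6 j).

Lemma blocksE A B C D :
  (ulblock (block6 A B C D) = A) * (dlblock (block6 A B C D) = C) * (drblock (block6 A B C D) = D).
Proof. by split; [split|]; apply/matrixP => i j; rewrite mxE block6E. Qed.

Lemma axial_sym_crossmx M w : M^T = M -> axial (M + crossmx w) = w.
Proof.
move=> MT; apply/rowP => i; have := congr1 (fun Z : 'M_3 => Z (i + 1) (i + 2)) MT.
by rewrite !mxE !ord3E !ord3_eqE => ->; field.
Qed.

Lemma mxtrace_crossmx w : \tr (crossmx w) = 0.
Proof. by rewrite /mxtrace big1 // => i _; rewrite !mxE !ord3_eqE. Qed.

Lemma outer_sym (a : R) u : (a *: (u^T *m u))^T = a *: (u^T *m u).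
Proof. by rewrite linearZ /= trmx_mul trmxK. Qed.

Lemma cs_param_blocks xi eta u v :
  (ulblock (cs_param xi eta u v) = xi *: (u^T *m u) + crossmx u) *
  (dlblock (cs_param xi eta u v) = eta *: (v^T *m u)) *
  (drblock (cs_param xi eta u v) = - xi *: (v^T *m v) + crossmx v).
Proof. by rewrite /cs_param !blocksE. Qed.

Lemma cs_param_axial xi eta u v :
  (axial (ulblock (cs_param xi eta u v)) = u) * (axial (drblock (cs_param xi eta u v)) = v).
Proof. by rewrite !cs_param_blocks !axial_sym_crossmx ?outer_sym. Qed.

Lemma cs_param_trace xi eta u v : unit_sphere u -> \tr (ulblock (cs_param xi eta u v)) = xi.
Proof.
move=> /sphereP uu; rewrite cs_param_blocks mxtraceD mxtrace_crossmx mxtraceZ mxtrace_mulC uu.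
by rewrite mxtrace_scalar mulr1 addr0.
Qed.

Lemma scale_outerE (a : R) u v i j : (a *: (u^T *m v)) i j = a * (u 0 i * v 0 j).
Proof. by rewrite !mxE big_ord1 mxE. Qed.

(** The parameters may depend on a point of any space, which serves both the inverse of the global
    diffeomorphism and the local graphs. *)
Lemma smooth_cs_param (V : normedModType R) (U : set V) (xi eta : V -> R) (u v : V -> 'rV[R]_3) :
  (forall p, U p -> eta p != 0) -> smooth_fun U xi -> smooth_fun U eta ->
  (forall i, smooth_fun U (fun p => u p 0 i)) -> (forall i, smooth_fun U (fun p => v p 0 i)) ->
  smooth_map U (fun p => cs_param (xi p) (eta p) (u p) (v p)).
Proof.
move=> eta0 sxi seta su sv.
have scross (w : V -> 'rV[R]_3) (sw : forall i, smooth_fun U (fun p => w p 0 i)) i j :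
    smooth_fun U (fun p => crossmx (w p) i j).
  move: j; apply: (@ord3_ind i).
  - by apply: smooth_fun_eq (smooth_fun_cst _ 0) => p _; rewrite crossmxE.
  - by apply: smooth_fun_eq (smooth_funN (sw (i + 2))) => p _; rewrite crossmxE.
  - by apply: smooth_fun_eq (sw (i + 1)) => p _; rewrite crossmxE.
have sbeta : smooth_fun U (fun p => - ((xi p ^+ 2 + 1) / eta p)).
  by apply/smooth_funN/smooth_funM;
    [apply/smooth_funD; [exact: smooth_funM|exact: smooth_fun_cst]|exact: smooth_funV].
apply: smooth_map_mx; apply: ord6P => i; apply: ord6P => j.
- apply: smooth_fun_eq (smooth_funD (smooth_funM sxi (smooth_funM (su i) (su j))) (scross _ su i
    j)) => p _.
  by rewrite /cs_param block6E [RHS]mxE scale_outerE.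
- apply: smooth_fun_eq (smooth_funM sbeta (smooth_funM (su i) (sv j))) => p _.
  by rewrite /cs_param block6E scale_outerE.
- apply: smooth_fun_eq (smooth_funM seta (smooth_funM (sv i) (su j))) => p _.
  by rewrite /cs_param block6E scale_outerE.
- apply: smooth_fun_eq (smooth_funD (smooth_funM (smooth_funN sxi) (smooth_funM (sv i) (sv j)))
    (scross _ sv i j)) => p _.
  by rewrite /cs_param block6E [RHS]mxE scale_outerE.
Qed.

Section Entrywise.
Context {V : normedModType R} {U : set V}.

(** Entrywise form, convenient for matrix products and brackets; it yields [smooth_map] through
    [smooth_map_mx]. *)
Definition smooth_mx m n (f : V -> 'M[R]_(m, n)) :=
  forall (a : 'I_m) (b : 'I_n), smooth_fun U (fun p => f p a b).

Lemma smooth_mxB m n (f g : V -> 'M[R]_(m, n)) : smooth_mx f -> smooth_mx g ->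
  smooth_mx (fun p => f p - g p).
Proof.
by move=> sf sg a b; apply: smooth_fun_eq (smooth_funD (sf a b) (smooth_funN (sg a b))) => p _;
  rewrite !mxE.
Qed.

Lemma smooth_mx_cst m n (N : 'M[R]_(m, n)) : smooth_mx (fun=> N).
Proof. by move=> a b; exact: smooth_fun_cst. Qed.

Lemma smooth_mxM m n k (f : V -> 'M[R]_(m, n)) (g : V -> 'M[R]_(n,
  k)) : smooth_mx f -> smooth_mx g ->
  smooth_mx (fun p => f p *m g p).
Proof.
move=> sf sg a b; apply: smooth_fun_eq (smooth_fun_sum (index_enum 'I_n) (P := xpredT)
  (fun c _ => smooth_funM (sf a c) (sg c b))) => p _.
by rewrite mxE.
Qed.

Lemma smooth_su2su2_bracket (f g : V -> 'cV[R]_6) : smooth_mx f -> smooth_mx g ->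
  smooth_mx (fun p => su2su2_bracket (f p) (g p)).
Proof.
move=> sf sg k l; rewrite {l}(ord1 l); move: k; apply: ord6P => i.
- apply: smooth_fun_eq (smooth_funD (smooth_funM (sf (lshift6 (i + 1)) 0) (sg (lshift6 (i + 2)) 0))
    (smooth_funN (smooth_funM (sf (lshift6 (i + 2)) 0) (sg (lshift6 (i + 1)) 0)))) => p _.
  by rewrite /su2su2_bracket [RHS]col_mxEu !mxE.
- apply: smooth_fun_eq (smooth_funD (smooth_funM (sf (rshift6 (i + 1)) 0) (sg (rshift6 (i + 2)) 0))
    (smooth_funN (smooth_funM (sf (rshift6 (i + 2)) 0) (sg (rshift6 (i + 1)) 0)))) => p _.
  by rewrite /su2su2_bracket [RHS]col_mxEd !mxE.
Qed.

End Entrywise.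

(** For each fixed pair X, Y the conditions are polynomial in the entries of J, so the set is an
    intersection of closed solution sets. *)
Lemma closed_complex_structures : closed [set J : 'M[R]_6 | complex_structure su2su2_bracket J].
Proof.
have -> : [set J : 'M[R]_6 | complex_structure su2su2_bracket J] =
   [set J | J *m J = - 1%:M] `&` \bigcap_(XY in [set: 'cV[R]_6 * 'cV[R]_6])
     [set J | su2su2_bracket (J *m XY.1) (J *m XY.2) - su2su2_bracket XY.1 XY.2
        - J *m su2su2_bracket (J *m XY.1) XY.2 - J *m su2su2_bracket XY.1 (J *m XY.2) = 0].
  apply/seteqP; split=> J [J2 N]; split=> //; first by move=> [X Y] _; exact: N.
  by move=> X Y; exact: (N (X, Y)).
have sid : @smooth_mx _ setT 6 6 id by move=> a b; exact: smooth_fun_coord.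
have sc := @smooth_mx_cst 'M[R]_6 setT.
apply: closedI; first by apply: closed_smooth_eq; exact: smooth_mxM.
apply: closed_bigI => -[X Y] _; apply: closed_smooth_eq.
have sX := smooth_mxM sid (sc _ _ X); have sY := smooth_mxM sid (sc _ _ Y).
apply: smooth_mxB; last by apply: smooth_mxM => //; exact: smooth_su2su2_bracket.
apply: smooth_mxB; last by apply: smooth_mxM => //; exact: smooth_su2su2_bracket.
by apply: smooth_mxB; exact: smooth_su2su2_bracket.
Qed.

End Topology.

(** * The global diffeomorphism with the model *)

Section Charts.
Context {R : realType}.
Implicit Types (u v w : 'rV[R]_3) (a b i j : 'I_3) (J : 'M[R]_6) (x : 'rV[R]_6).

Lemma smooth_block (F G : 'I_3 -> 'I_6) :
  @smooth_mx R _ setT _ _ (fun J => \matrix_(i, j) J (F i) (G j) : 'M[R]_3).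
Proof.
by move=> i j; apply: smooth_fun_eq (smooth_fun_coord setT (F i) (G j)) => J _; rewrite mxE.
Qed.

Lemma smooth_axial (F : 'I_3 -> 'I_6) :
  @smooth_mx R _ setT _ _ (fun J => axial (\matrix_(i, j) J (F i) (F j))).
Proof.
move=> k i; apply: smooth_fun_eq (smooth_funM (smooth_funD (smooth_block F F (i + 2) (i + 1))
  (smooth_funN (smooth_block F F (i + 1) (i + 2)))) (smooth_fun_cst _ 2^-1)) => J _.
by rewrite [RHS]mxE.
Qed.

Lemma diffeomorphic_complex_structures :
  diffeomorphic [set J | complex_structure su2su2_bracket J] (@model_space R).
Proof.
(* On the family v C u^T = eta (v v^T)(u u^T) = eta, so polynomials in J recover all parameters. *)
pose f J := ((\tr (ulblock J), (axial (drblock J) *m dlblock J *m (axial (ulblock J))^T) 0 0),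
             (axial (ulblock J), axial (drblock J))).
pose g (q : (R * R) * ('rV[R]_3 * 'rV[R]_3)) := cs_param q.1.1 q.1.2 q.2.1 q.2.2.
have fK xi eta u v : unit_sphere u -> unit_sphere v ->
    f (cs_param xi eta u v) = ((xi, eta), (u, v)).
  move=> uu vv; rewrite /f cs_param_trace // !cs_param_axial !cs_param_blocks.
  move/sphereP: uu => uu; move/sphereP: vv => vv.
  by rewrite -scalemxAr -scalemxAl mulmxA vv mul1mx uu scalemx1 mxE eqxx mulr1n.
exists f, g; split.
- apply: (smooth_map_smooth_on openT) => //.
  apply: smooth_map_pair; apply: smooth_map_pair.
  + by apply: smooth_map_fun; apply: smooth_fun_sum => i _; exact: smooth_block.
  + apply: smooth_map_fun.
    have sT : smooth_mx (U := setT) (fun J => (axial (ulblock J))^T).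
      by move=> i k; apply: smooth_fun_eq (smooth_axial lshift6 k i) => J _; rewrite [RHS]mxE.
    apply: (smooth_mxM _ sT); apply: smooth_mxM; first exact: smooth_axial.
    by move=> i j; exact: smooth_block.
  + by apply: smooth_map_mx; exact: smooth_axial.
  + by apply: smooth_map_mx; exact: smooth_axial.
- have sR : smooth_fun setT (id : R -> R).
    by apply: (@smooth_fun_lin _ R setT idfun) => r; exact: cvg_id.
  have sfst (V W : normedModType R) (h : V -> R) : smooth_fun setT h ->
      smooth_fun setT (fun q : V * W => h q.1).
    by move=> sh; apply: (@smooth_fun_linr _ V (V * W)%type fst setT h _ sh) => q; exact: cvg_fst.
  have ssnd (V W : normedModType R) (h : W -> R) : smooth_fun setT h ->
      smooth_fun setT (fun q : V * W => h q.2).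
    by move=> sh; apply: (@smooth_fun_linr _ W (V * W)%type snd setT h _ sh) => q; exact: cvg_snd.
  (* The formula for [g] divides by eta and is smooth on the open set eta <> 0, which contains the
     model. *)
  apply: (@smooth_map_smooth_on _ _ _ _ [set q | q.1.2 != 0]).
  + by apply: open_smooth_neq0; exact: (sfst _ _ snd (ssnd _ _ _ sR)).
  + by move=> q [].
  + have sub h : smooth_fun setT h -> smooth_fun [set q : (R * R) * ('rV[R]_3 * 'rV[R]_3) | q.1.2
      != 0] h.
      exact: smooth_fun_sub.
    apply: smooth_cs_param => //.
    * exact: sub _ (sfst _ _ fst (sfst _ _ _ sR)).
    * exact: sub _ (sfst _ _ snd (ssnd _ _ _ sR)).
    * by move=> i; apply: sub _ (ssnd _ _ _ (sfst _ _ _ (smooth_fun_coord setT 0 i))).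
    * by move=> i; apply: sub _ (ssnd _ _ _ (ssnd _ _ _ (smooth_fun_coord setT 0 i))).
- move=> _ /complex_structure_cs_param[xi [eta [u [v [e0 uu vv ->]]]]].
  by rewrite fK.
- by move=> [[xi eta] [u v]] [/= e0 uu vv]; rewrite fK //; split=> //;
    exact: cs_param_complex_structure.
Qed.

(** * Local charts: hemispheres and six linear coordinates *)

Definition row6 (s : seq R) : 'rV[R]_6 := \row_(k < 6) s`_k.

Lemma row6E (s : seq R) k : (k < 6)%N -> row6 s 0 (inord k) = s`_k.
Proof. by move=> k6; rewrite mxE inordK. Qed.

Lemma row6_eta x : row6 [:: x 0 (inord 0); x 0 (inord 1); x 0 (inord 2);
  x 0 (inord 3); x 0 (inord 4); x 0 (inord 5)] = x.
Proof.
by apply/rowP => k; rewrite mxE -[in RHS](inord_val k); case: k => -[|[|[|[|[|[|//]]]]]].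
Qed.

Definition place a (t y z : R) : 'rV[R]_3 :=
  \row_i (if i == a then t else if i == a + 1 then y else z).

Lemma placeE a t y z : (place a t y z 0 a = t) * (place a t y z 0 (a + 1) = y) *
  (place a t y z 0 (a + 2) = z).
Proof. by rewrite !mxE !ord3_eqE. Qed.

(** For a sign [e], the half sphere e u_a > 0 as a graph over the open unit disk in the two other
    coordinates. *)
Definition hemi a (e y z : R) : 'rV[R]_3 := place a (e * Num.sqrt (1 - (y ^+ 2 + z ^+ 2))) y z.

Lemma hemi_sphere a e y z : e ^+ 2 = 1 -> y ^+ 2 + z ^+ 2 < 1 -> unit_sphere (hemi a e y z).
Proof.
move=> e1 yz; rewrite /unit_sphere /= (sum3 _ a) !placeE exprMn e1 sqr_sqrtr; last lra.
ring.
Qed.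

Lemma hemi_eq a e u : e ^+ 2 = 1 -> 0 < e * u 0 a -> unit_sphere u ->
  hemi a e (u 0 (a + 1)) (u 0 (a + 2)) = u.
Proof.
rewrite /unit_sphere /= (sum3 _ a) => e1 eu uu.
apply/rowP; apply: (@ord3_ind a); rewrite !placeE //.
have -> : 1 - (u 0 (a + 1) ^+ 2 + u 0 (a + 2) ^+ 2) = (e * u 0 a) ^+ 2.
  by rewrite exprMn e1; lra.
by rewrite sqrtr_sqr gtr0_norm // mulrA -expr2 e1 mul1r.
Qed.

Lemma hemi_gt0 a e y z : e ^+ 2 = 1 -> y ^+ 2 + z ^+ 2 < 1 -> 0 < e * hemi a e y z 0 a.
Proof.
by move=> e1 yz; rewrite placeE mulrA -expr2 e1 mul1r sqrtr_gt0; lra.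
Qed.

Lemma sphere_open_disk a u : unit_sphere u -> u 0 a != 0 ->
  u 0 (a + 1) ^+ 2 + u 0 (a + 2) ^+ 2 < 1.
Proof.
rewrite /unit_sphere /= (sum3 _ a) => uu u0.
have : 0 < u 0 a ^+ 2 by rewrite exprn_even_gt0.
lra.
Qed.

Lemma sg_unit (r : R) : r != 0 -> Num.sg r ^+ 2 = 1 /\ 0 < Num.sg r * r.
Proof. by move=> r0; rewrite sqr_sg r0 -normrEsg normr_gt0. Qed.

Lemma smooth_hemi (V : normedModType R) (U : set V) a e (y z : V -> R) i :
  smooth_fun U y -> smooth_fun U z -> (forall p, U p -> y p ^+ 2 + z p ^+ 2 < 1) ->
  smooth_fun U (fun p => hemi a e (y p) (z p) 0 i).
Proof.
move=> sy sz yz; move: i; apply: (@ord3_ind a).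
- have ss : smooth_fun U (fun p => 1 - (y p ^+ 2 + z p ^+ 2)).
    by apply: smooth_funD (smooth_fun_cst _ _) _; apply: smooth_funN; apply: smooth_funD;
      exact: smooth_funM.
  have s0 p : U p -> 0 < 1 - (y p ^+ 2 + z p ^+ 2) by move=> /yz; lra.
  apply: smooth_fun_eq (smooth_funM (smooth_fun_cst U e) (smooth_fun_sqrt s0 ss)) => p _.
  by rewrite placeE.
- by apply: smooth_fun_eq sy => p _; rewrite placeE.
- by apply: smooth_fun_eq sz => p _; rewrite placeE.
Qed.

(** The second entry is C_ba = eta v_b u_a instead of eta: it is linear in J and still determines
    eta where u_a and v_b are nonzero. *)
Definition chart_coord a b J : 'rV[R]_6 :=
  row6 [:: \tr (ulblock J); dlblock J b a;
    axial (ulblock J) 0 (a + 1); axial (ulblock J) 0 (a + 2);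
    axial (drblock J) 0 (b + 1); axial (drblock J) 0 (b + 2)].

Lemma chart_coord_linear a b : linear (chart_coord a b).
Proof.
move=> c J J'; apply/rowP => -[[|[|[|[|[|[|//]]]]]] ?]; rewrite !mxE /=.
- rewrite /mxtrace mulr_sumr -big_split /=; apply: eq_bigr => i _; by rewrite ?mxE.
all: by rewrite ?mxE; field.
all: by rewrite !mxE; field.
Qed.

HB.instance Definition _ a b := GRing.isLinear.Build R 'M[R]_6 'rV[R]_6 _ (chart_coord a b)
  (chart_coord_linear a b).

(** Witnesses that the coordinates are onto; its values have a zero block and are not complex
    structures. *)
Definition chart_section a b x : 'M[R]_6 :=
  block6 (x 0 (inord 0) *: delta_mx 0 0 + crossmx (place a 0 (x 0 (inord 2)) (x 0 (inord 3))))
    0 (x 0 (inord 1) *: delta_mx b a) (crossmx (place b 0 (x 0 (inord 4)) (x 0 (inord 5)))).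

Lemma chart_sectionK a b : cancel (chart_section a b) (chart_coord a b).
Proof.
move=> x; rewrite /chart_coord /chart_section !blocksE axial_sym_crossmx; last first.
  by rewrite linearZ /= trmx_delta.
rewrite -[crossmx (place b _ _ _)]add0r axial_sym_crossmx ?trmx0 // !placeE.
rewrite mxtraceD mxtrace_crossmx mxtraceZ [\tr (delta_mx _ _)](sum3 _ 0) !mxE !eqxx !ord3_eqE /=.
by rewrite !mulr0n !addr0 !mulr1 row6_eta.
Qed.

(** Inverse of the coordinates on the part of the family where u_a and v_b have the signs e and
    e'. *)
Definition chart_param a b (e e' : R) x : 'M[R]_6 :=
  let u := hemi a e (x 0 (inord 2)) (x 0 (inord 3)) in
  let v := hemi b e' (x 0 (inord 4)) (x 0 (inord 5)) in
  cs_param (x 0 (inord 0)) (x 0 (inord 1) / (v 0 b * u 0 a)) u v.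

Lemma chart_coord_cs_param a b xi eta u v : unit_sphere u ->
  chart_coord a b (cs_param xi eta u v) = row6 [:: xi; eta * (v 0 b * u 0 a);
    u 0 (a + 1); u 0 (a + 2); v 0 (b + 1); v 0 (b + 2)].
Proof.
by move=> uu; rewrite /chart_coord cs_param_trace // !cs_param_axial cs_param_blocks scale_outerE.
Qed.

Lemma submanifold_complex_structures :
  smooth_submanifold 36 6 [set J : 'M[R]_6 | complex_structure su2su2_bracket J].
Proof.
apply: (@graph_submanifold _ 6 6 6) => // _ /complex_structure_cs_param[xi [eta [u0 [v0 [eta0 uu
  vv ->]]]]].
have sphere_neq0 w : unit_sphere w -> exists a, w 0 a != 0.
  move=> /sphereP ww; apply/rV0Pn; apply: contra_eq_neq ww => ->.
  rewrite mul0mx; apply/eqP => /(congr1 (fun Z : 'M_1 => Z 0 0)) /eqP.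
  by rewrite !mxE eqxx mulr1n eq_sym oner_eq0.
have [a ua] := sphere_neq0 _ uu; have [b vb] := sphere_neq0 _ vv.
have [e1 eu] := sg_unit ua; have [e1' ev] := sg_unit vb.
(* These signs select the hemispheres containing the two unit vectors of the base point. *)
set e := Num.sg _ in e1 eu; set e' := Num.sg _ in e1' ev.
pose D := [set x : 'rV[R]_6 | [/\ x 0 (inord 1) != 0, x 0 (inord 2) ^+ 2 + x 0 (inord 3) ^+ 2 < 1 &
  x 0 (inord 4) ^+ 2 + x 0 (inord 5) ^+ 2 < 1]].
(* The hemispheres are imposed through the axial vectors, so that U is open in the space of all
   matrices. *)
pose U := [set J : 'M[R]_6 | 0 < e * axial (ulblock J) 0 a /\ 0 < e' * axial (drblock J) 0 b].
have Dneq x : D x -> hemi b e' (x 0 (inord 4)) (x 0 (inord 5)) 0 b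
    * hemi a e (x 0 (inord 2)) (x 0 (inord 3)) 0 a != 0.
  move=> [_ /(hemi_gt0 a e1) Hu /(hemi_gt0 b e1') Hv]; apply: mulf_neq0.
    by apply: contraTneq Hv => ->; rewrite mulr0 ltxx.
  by apply: contraTneq Hu => ->; rewrite mulr0 ltxx.
exists (chart_coord a b), (chart_section a b), (chart_param a b e e'), D, U.
split; first exact: chart_sectionK.
- split.
    have -> : D = [set x | x 0 (inord 1) != 0] `&`
      ([set x | 0 < 1 - (x 0 (inord 2) ^+ 2 + x 0 (inord 3) ^+ 2)] `&`
       [set x | 0 < 1 - (x 0 (inord 4) ^+ 2 + x 0 (inord 5) ^+ 2)]).
      by apply/seteqP; split=> x; rewrite /D /setI /= !subr_gt0 => -[? [? ?]] || move=> [? ? ?].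
    have sc k : smooth_fun setT (fun x => x 0 k) by exact: smooth_fun_coord.
    apply: openI; first exact: open_smooth_neq0.
    by apply: openI; apply: open_smooth_gt0; apply: smooth_funD (smooth_fun_cst _ _) _;
      apply: smooth_funN; apply: smooth_funD; exact: smooth_funM.
  have sax F c k : smooth_fun setT (fun J => c * axial (\matrix_(i, j) J (F i) (F j)) 0 k).
    by apply: smooth_funM (smooth_fun_cst _ c) _; exact: smooth_axial.
  by apply: (@openI _ [set J | _] [set J | _]); apply: open_smooth_gt0; exact: sax.
- rewrite /= chart_coord_cs_param // /D /U /= !row6E //= !cs_param_axial.
  by split=> //; split; rewrite ?mulf_neq0 ?sphere_open_disk.
- have sc k : smooth_fun D (fun x => x 0 k) by exact: smooth_fun_coord.
  have su i : smooth_fun D (fun x => hemi a e (x 0 (inord 2)) (x 0 (inord 3)) 0 i).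
    by apply: smooth_hemi => // x [].
  have sv i : smooth_fun D (fun x => hemi b e' (x 0 (inord 4)) (x 0 (inord 5)) 0 i).
    by apply: smooth_hemi => // x [].
  apply: smooth_cs_param => //.
    by move=> x Dx; have [x1 _ _] := Dx; rewrite mulf_neq0 ?invr_eq0 ?Dneq.
  by apply: smooth_funM => //; apply: smooth_funV => //; exact: smooth_funM.
split=> [x Dx|J [Ju Jv] DJ].
  have [x1 x23 x45] := Dx.
  rewrite /= /chart_param chart_coord_cs_param; last exact: hemi_sphere.
  rewrite divfK ?Dneq //.
  by rewrite /hemi !placeE row6_eta.
(* A complex structure in [U] is rebuilt from its coordinates; conversely the values of the graph
   over [D] are complex structures. *)
split=> [|<-].
  move=> /complex_structure_cs_param[xi' [eta' [u [v [eta0' uu' vv' JE]]]]].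
  rewrite JE !cs_param_axial in Ju Jv *.
  have uan : u 0 a != 0 by apply: contraTneq Ju => ->; rewrite mulr0 ltxx.
  have vbn : v 0 b != 0 by apply: contraTneq Jv => ->; rewrite mulr0 ltxx.
  rewrite /= chart_coord_cs_param // /chart_param !row6E //= !hemi_eq // mulfK ?mulf_neq0 //.
have [x1 x23 x45] := DJ.
by apply: cs_param_complex_structure; [rewrite mulf_neq0 ?invr_eq0 ?Dneq|exact: hemi_sphere..].
Qed.

End Charts.

Unset Implicit Arguments.

Theorem corollary5 (R : realType) :
  let CS : set 'M[R]_6 := [set J | complex_structure su2su2_bracket J] in
  [/\ closed CS, smooth_submanifold 36 6 CS & diffeomorphic CS (@model_space R)].
Proof.
split.
- exact: closed_complex_structures.
- exact: submanifold_complex_structures.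
- exact: diffeomorphic_complex_structures.
Qed.
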